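(* Let $(X,d,\mu)$ be a metric measure space with doubling measure $\mu$. Assume that $\mu$ satisfies the measure lower bound condition with exponent $Q$ for some $Q\in(0,\infty)$, and that $X$ has the relative $1$-annular decay property. Let $1<p\le q<\infty$ and $\alpha\in[0,Q/q)$. Then, for any $f\in HM_p^q(X)$, $\widetilde M_\alpha f\in HM_{p^*}^{q^*}(X)$, where $p^*:=\frac{Qp}{Q-\alpha q}$ and $q^*:=\frac{Qq}{Q-\alpha q}$. Moreover, there exists a positive constant $C$, depending only on the doubling constant, $Q$, $p$, $q$ and $\alpha$, such that, for all $f\in HM_p^q(X)$, $$\left\|\widetilde M_\alpha f\right\|_{HM_{p^*}^{q^*}(X)}\le C\|f\|_{HM_p^q(X)}.$$
   Context: Throughout, $(X,d,\mu)$ is a metric space with a non-trivial Borel regular measure $\mu$ which is finite on bounded sets and positive on (non-empty) open sets. $\mu$ is doubling if there is $C_0\in[1,\infty)$ (the doubling constant) with $\mu(B(x,2r))\le C_0\mu(B(x,r))$ for all $x\in X$, $r>0$. $\mu$ satisfies the measure lower bound condition with exponent $Q\in(0,\infty)$ if there is a positive constant $c$ such that $\mu(B(x,r))\ge c\,r^Q$ for all $x\in X$ and $r\in(0,\infty)$. $X$ has the relative $1$-annular decay property if there is a positive constant $C_1$ such that, for all $x\in X$, $R\in(0,\infty)$ and $h\in(0,R)$, $$\mu\left(B\cap[B(x,R)\setminus B(x,R-h)]\right)\le C_1\frac{h}{r_B}\mu(B)$$ for all balls $B$ with radius $r_B<3R$. The (fractional) maximal operator is $$\widetilde M_\alpha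 f(x):=\sup_{r>0}\frac{r^\alpha}{\mu(B(x,r))}\int_{B(x,r)}|f(y)|\,d\mu(y),\qquad f\in L^1_{\mathrm{loc}}(X),\ x\in X.$$ Morrey space: for $0<p\le q\le\infty$, $\mathcal{M}_p^q(X)$ is the space of all measurable functions $f$ on $X$ with $$\|f\|_{\mathcal{M}_p^q(X)}:=\sup_{B\subset X}[\mu(B)]^{1/q-1/p}\left[\int_B|f(x)|^p\,d\mu(x)\right]^{1/p}<\infty,$$ the supremum being over all balls $B$ in $X$. A non-negative function $h$ on $X$ is a Hajłasz gradient of a measurable function $f$ if there is $E\subset X$ with $\mu(E)=0$ such that $|f(x)-f(y)|\le d(x,y)[h(x)+h(y)]$ for all $x,y\in X\setminus E$. The Hajłasz-Morrey-Sobolev space $HM_p^q(X)$ is the space of measurable $f$ that have a Hajłasz gradient $h\in\mathcal{M}_p^q(X)$ and for which $\|f\|_{HM_p^q(X)}:=\|f\|_{\mathcal{M}_p^q(X)}+\inf\|h\|_{\mathcal{M}_p^q(X)}<\infty$, the infimum being over all Hajłasz gradients $h$ of $f$.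
   Formalization: The constant C may also depend on the constant c of the measure lower bound condition and on C_1 of the relative 1-annular decay property; a bound independent of them is false (for α>0, replace μ by tμ and let t→0). *)

(* Defs.v *)
From HB Require Import structures.
From mathcomp Require Import all_boot all_order all_algebra.
From mathcomp Require Import all_classical all_reals all_analysis.
From mathcomp Require Import measurable_realfun.

Set Implicit Arguments.
Unset Strict Implicit.
Unset Printing Implicit Defensive.

Import Order.TTheory GRing.Theory Num.Theory.

Local Open Scope classical_set_scope.
Local Open Scope ring_scope.

(* The Caratheodory sigma-algebra is only available over a pointed type. The
   point carries no information: the spaces below have non-zero measure. *)
#[short(type="pmetricType")]
HB.structure Definition PointedMetric (K : numDomainType) :=
  { M of Metric K M & isPointed M }.

(* A Borel regular measure is, as usual in analysis on metric spaces, an outer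
   measure; "measurable" means Caratheodory measurable, and integrals are taken
   with respect to the restriction of mu to the Caratheodory measurable sets.
   Balls are open balls, with given centre and radius. *)
Section MetricMeasureSpace.
Context (R : realType) (X : pmetricType R).
Variable mu : {outer_measure set X -> \bar R}.

Local Open Scope ereal_scope.

Definition cara_measure : {measure set (caratheodory_type mu) -> \bar R} :=
  (mu : set (caratheodory_type mu) -> \bar R).

Record metric_measure : Prop := {
  borel_measurable : forall A : set X,
    <<s [set U : set X | open U] >> A -> mu.-caratheodory A ;
  borel_regular : forall A : set X, exists B : set X,
    [/\ <<s [set U : set X | open U] >> B, A `<=` B & mu B = mu A] ;
  nontrivial_measure : mu setT != 0 ;
  finite_on_bounded : forall A : set X,
    (exists (x : X) (r : R), A `<=` ball x r) -> mu A < +oo ;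
  positive_on_open : forall U : set X, open U -> U !=set0 -> 0 < mu U
}.

Definition doubling (C0 : R) : Prop := forall (x : X) (r : R), (0 < r)%R ->
  mu (ball x (2 * r)%R) <= C0%:E * mu (ball x r).

Definition measure_lower_bound (c Q : R) : Prop :=
  forall (x : X) (r : R), (0 < r)%R -> (c * r `^ Q)%:E <= mu (ball x r).

Definition relative_1_annular_decay (C1 : R) : Prop :=
  forall (x : X) (rho h : R), (0 < h)%R -> (h < rho)%R ->
  forall (z : X) (rB : R), (0 < rB)%R -> (rB < 3 * rho)%R ->
  mu (ball z rB `&` (ball x rho `\` ball x (rho - h)%R)) <=
    (C1 * (h / rB))%:E * mu (ball z rB).

(* Functions take values in [-oo, +oo], since the maximal function below may be
   infinite on a null set. The quotients by mu (ball x r) and the real powers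
   of it are only used for balls of finite positive measure. *)
Definition fractional_maximal (alpha : R) (f : X -> \bar R) (x : X) : \bar R :=
  ereal_sup [set (r `^ alpha / fine (mu (ball x r)))%:E *
                 \int[cara_measure]_(y in ball x r) `|f y|
            | r in [set r : R | (0 < r)%R]].

Definition morrey_norm (p q : R) (f : X -> \bar R) : \bar R :=
  ereal_sup [set mu (ball b.1 b.2) `^ (q^-1 - p^-1) *
                 (\int[cara_measure]_(y in ball b.1 b.2) (`|f y| `^ p)) `^ p^-1
            | b in [set b : X * R | (0 < b.2)%R]].

Definition measurable_function (f : X -> \bar R) : Prop :=
  measurable_fun [set: caratheodory_type mu] f.

Definition morrey_space (p q : R) (f : X -> \bar R) : Prop :=
  measurable_function f /\ morrey_norm p q f < +oo.

(* In \bar R, `|f x - f x| = +oo when f x is infinite, whereas the right-hand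
   side is 0 for x = y, even if h x = +oo: hence a function with a Hajlasz
   gradient is finite outside the null set E. *)
Definition hajlasz_gradient (f h : X -> \bar R) : Prop :=
  (forall x, 0 <= h x) /\
  exists2 E : set X, mu E = 0 &
    forall x y, ~ E x -> ~ E y ->
      `|f x - f y| <= (mdist x y)%:E * (h x + h y).

(* The infimum of the empty set is +oo. *)
Definition hajlasz_morrey_sobolev_norm (p q : R) (f : X -> \bar R) : \bar R :=
  morrey_norm p q f +
  ereal_inf [set morrey_norm p q h
            | h in [set h | measurable_function h /\ hajlasz_gradient f h]].

Definition hajlasz_morrey_sobolev (p q : R) (f : X -> \bar R) : Prop :=
  [/\ measurable_function f,
      exists2 h, hajlasz_gradient f h & morrey_space p q h &
      hajlasz_morrey_sobolev_norm p q f < +oo].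

End MetricMeasureSpace.

(* Main.v *)
Require Import Defs.
From HB Require Import structures.
From mathcomp Require Import all_boot all_order all_algebra.
From mathcomp Require Import all_classical all_reals all_analysis.
From mathcomp Require Import measurable_realfun.
From mathcomp Require Import ring lra.

(** Why the theorem holds.  Write [M_a f] for the fractional maximal function of
    order [a], and [M f] for [M_0 f].

    Size.  Let [A_r] be the mean of [|f|] over the ball of radius [r] around [x].
    With [theta = alpha * q / Q], the fractional mean [r ^ alpha * A_r] is the
    product of [A_r ^ (1 - theta)] and [(r ^ (Q / q) * A_r) ^ theta].  The first
    factor is at most [M f x ^ (1 - theta)]; the Morrey condition and the lower
    bound on the masses of balls bound the second by a power of the Morrey norm
    ([adams_pointwise]).  Since [(1 - theta) * pstar = p], it remains to bound [M]
    on the Morrey space ([adams]).  This localizes ([morrey_maximal]) the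
    Hardy-Littlewood theorem ([maximal_strong]).  That theorem is proved for
    finitely many balls, by Doob's argument, from a weak type inequality whose
    right-hand side is the integral over the level set itself ([weak_type],
    [top_value_doob]); nets reduce the full supremum to countably many balls
    ([dense_balls]).  The function [M_a f] is lower semicontinuous, hence
    measurable ([open_fractional_maximal]).

    Gradient.  Let [f >= 0] have the gradient [g], let [r = mdist x y > 0], and let
    [c] be the mean of [f] over [ball x rho].  As [ball y (rho + r)] contains
    [ball x rho] and [f >= 0], its mean falls short of [c] by at most the integral
    of [|f - c|] over the annulus between the radii [rho] and [rho + 2 * r] around
    [x], divided by the mass of the ball ([mean_shift]).  This integral has to be
    linear in [r].  Comparing at each point of the annulus the means of [f] over
    balls of radii [2 ^ j * r] ([telescope]) bounds it by means of [g] at these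
    scales.  At scale [t], the annular decay inside balls of radius [t] gains the
    factor [r / t], which offsets the factor [t] of the Hajlasz inequality.  With
    integrals of [g] alone all scales would contribute equally, and a logarithm of
    [rho / r] would remain.  Means of [g ^ s] with [s > 1] leave, by Hölder's
    inequality on an annulus of width comparable to [t], the additional factor
    [(t / rho) ^ (1 - 1 / s)] ([scale_bound]), and the scales sum up
    ([annulus_oscillation]).

    Consequently a multiple of [M_(alpha s) (g ^ s) ^ (1 / s)] is a gradient of
    [M_alpha f] ([fractional_hajlasz_gradient]).  For [s = (1 + p) / 2], which
    lies between [1] and [p], the size estimate applies to [g ^ s] with the
    exponents [p / s] and [q / s] and the order [alpha * s]: the value of [theta]
    is the same, so the resulting exponents are [pstar] and [qstar]. *)

Set Implicit Arguments.
Unset Strict Implicit.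
Unset Printing Implicit Defensive.

Import Order.TTheory GRing.Theory Num.Theory.

Local Open Scope classical_set_scope.
Local Open Scope ring_scope.

(** * Balls, masses and finite nets *)

Section Integrals.
Local Open Scope ereal_scope.
Context d (T : measurableType d) (R : realType) (nu : {measure set T -> \bar R}).

(** The integral of a nonnegative function is a supremum over the simple functions
    below it, hence monotone in the function and in the set. *)
Lemma ge0_le_integral_sub (A B : set T) (f g : T -> \bar R) : A `<=` B ->
  (forall x, B x -> 0 <= g x) -> (forall x, A x -> 0 <= f x) ->
  (forall x, A x -> f x <= g x) ->
  \int[nu]_(x in A) f x <= \int[nu]_(x in B) g x.
Proof.
move=> AB g0 f0 fg; rewrite integral_mkcond [leRHS]integral_mkcond.
have hA x : 0 <= (f \_ A) x by apply: erestrict_ge0.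
have hB x : 0 <= (g \_ B) x by apply: erestrict_ge0.
rewrite !ge0_integralTE//; apply: ereal_sup_le => _ [h hf <-]; exists h => //.
move=> x; apply: (le_trans (hf x)); rewrite /patch.
case: ifPn => xA; last by apply: hB.
by rewrite inE in xA; rewrite ifT ?fg// inE; exact: AB.
Qed.

Lemma ge0_le_integral_fun (A : set T) (f g : T -> \bar R) :
  (forall x, A x -> 0 <= f x) -> (forall x, A x -> f x <= g x) ->
  \int[nu]_(x in A) f x <= \int[nu]_(x in A) g x.
Proof.
move=> f0 fg; apply: ge0_le_integral_sub => // x Ax.
exact: le_trans (f0 _ Ax) (fg _ Ax).
Qed.

Lemma ge0_le_integral_set (A B : set T) (f : T -> \bar R) : A `<=` B ->
  (forall x, B x -> 0 <= f x) ->
  \int[nu]_(x in A) f x <= \int[nu]_(x in B) f x.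
Proof. by move=> AB f0; apply: ge0_le_integral_sub => // x /AB /f0. Qed.

Lemma measurable_erestrict (A : set T) (f : T -> \bar R) : measurable A ->
  measurable_fun setT f -> measurable_fun setT (f \_ A).
Proof.
move=> mA mf; apply/(measurable_restrictT f mA); exact: measurable_funTS.
Qed.

(** After exchanging sum and integral, no point of [U] is counted more than [K]
    times. *)
Lemma sum_integral_overlap (I : eqType) (s : seq I) (B : I -> set T)
    (U : set T) (F : T -> \bar R) (K : R) :
  (forall i, measurable (B i)) -> measurable U -> (0 <= K)%R ->
  (forall i, i \in s -> B i `<=` U) ->
  (forall x, U x -> (\sum_(i <- s) \1_(B i) x <= K)%R) ->
  (forall x, 0 <= F x) -> measurable_fun setT F ->
  \sum_(i <- s) \int[nu]_(x in B i) F x <= K%:E * \int[nu]_(x in U) F x.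
Proof.
move=> mB mU K0 BU cK F0 mF.
under eq_bigr do rewrite integral_mkcond.
have mFB i : measurable_fun setT (F \_ (B i)).
  exact: measurable_erestrict.
rewrite -ge0_integral_sum//; last first.
  by move=> i x _; apply: erestrict_ge0.
rewrite -ge0_integralZl//; last exact: measurable_funTS.
rewrite [leRHS]integral_mkcond; apply: ge0_le_integral_fun => x _.
  by apply: sume_ge0 => i _; apply: erestrict_ge0.
rewrite /patch; case: ifPn => xU; last first.
  rewrite big_seq big1// => i /BU Bi; rewrite memNset// => /Bi.
  by move: xU; rewrite notin_setE.
rewrite (eq_bigr (fun i => (\1_(B i) x)%:E * F x)); last first.
  by move=> i _; rewrite indicE; case: (x \in B i); rewrite ?mul1e ?mul0e.
rewrite -ge0_sume_distrl; last by move=> i _; rewrite lee_fin.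
rewrite sumEFin lee_wpmul2r// lee_fin.
by apply: cK; rewrite inE in xU.
Qed.

End Integrals.

Section Balls.
Context (R : realType) (X : pmetricType R).
Variable mu : {outer_measure set X -> \bar R}.
Hypothesis hM : metric_measure mu.
Local Notation nu := (cara_measure mu).

Definition ball_mass (x : X) (r : R) : R := fine (mu (ball x r)).
Local Notation m := ball_mass.

Lemma ballP (x y : X) (r : R) : ball x r y <-> mdist x y < r.
Proof. by rewrite ballEmdist. Qed.

Lemma ball_sub (x y : X) (r s : R) : mdist x y + r <= s -> ball y r `<=` ball x s.
Proof.
move=> h z /ballP yz; apply/ballP.
apply: le_lt_trans (metric_triangle x y z) _.
by apply: lt_le_trans h; rewrite ltrD2l.
Qed.

Lemma open_metric_ball (x : X) (r : R) : open (ball x r).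
Proof.
rewrite openE => y /= /ballP xy; apply/nbhs_ballP.
exists (r - mdist x y) => /=; first by rewrite subr_gt0.
by apply: ball_sub; rewrite addrCA subrr addr0.
Qed.

Lemma open_cara (U : set X) : open U -> mu.-cara.-measurable U.
Proof. by move=> oU; apply: (borel_measurable hM); exact: sub_sigma_algebra. Qed.

Lemma cara_ball (x : X) (r : R) : mu.-cara.-measurable (ball x r).
Proof. by apply: open_cara; exact: open_metric_ball. Qed.

Lemma ball_massE (x : X) (r : R) : mu (ball x r) = (m x r)%:E.
Proof.
rewrite /m fineK// ge0_fin_numE ?outer_measure_ge0//.
by apply: (finite_on_bounded hM); exists x, r.
Qed.

Lemma cara_ball_massE (x : X) (r : R) : nu (ball x r) = (m x r)%:E.
Proof. exact: ball_massE. Qed.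

Lemma ball_mass_gt0 (x : X) (r : R) : 0 < r -> 0 < m x r.
Proof.
move=> r0; rewrite -lte_fin -ball_massE; apply: (positive_on_open hM).
  exact: open_metric_ball.
by exists x; apply/ballP; rewrite mdistxx.
Qed.

Lemma ball_mass_ge0 (x : X) (r : R) : 0 <= m x r.
Proof. by rewrite -lee_fin -ball_massE outer_measure_ge0. Qed.

Lemma ball_mass_le (x y : X) (r s : R) : mdist x y + r <= s -> m y r <= m x s.
Proof.
by move=> h; rewrite -lee_fin -!ball_massE le_outer_measure//; exact: ball_sub.
Qed.

Section Doubling.
Variable C0 : R.
Hypothesis hC0 : 1 <= C0.
Hypothesis hD : doubling mu C0.

Lemma ball_mass_double (k : nat) (x : X) (r : R) : 0 < r ->
  m x (2 ^+ k * r) <= C0 ^+ k * m x r.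
Proof.
move=> r0; elim: k => [|k ih]; first by rewrite !expr0 !mul1r.
have r1 : 0 < 2 ^+ k * r by rewrite mulr_gt0// exprn_gt0.
have := hD x r1; rewrite !ball_massE -EFinM lee_fin mulrA -exprS => h.
apply: (le_trans h); rewrite exprS -mulrA ler_wpM2l//.
exact: le_trans hC0.
Qed.

Lemma ball_mass_cmp (k : nat) (x y : X) (r s : R) : 0 < r ->
  mdist y x + s <= 2 ^+ k * r -> m x s <= C0 ^+ k * m y r.
Proof.
by move=> r0 h; apply: le_trans (ball_mass_double k y r0); exact: ball_mass_le.
Qed.

(** Halved balls around separated points are disjoint, and each carries a fixed
    fraction of the mass of a ball that contains them all. *)
Lemma size_separated (k : nat) (v : X) (t r : R) (s : seq X) : 0 < t -> 0 <= r ->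
  pairwise (fun x y => t <= mdist x y) s ->
  (forall z, z \in s -> mdist v z < r) ->
  2 * r + t / 2 <= 2 ^+ k * (t / 2) -> (size s)%:R <= C0 ^+ k.
Proof.
move=> t0 r0 seps sr hk.
have t20 : 0 < t / 2 by rewrite divr_gt0.
have rt0 : 0 < r + t / 2 by rewrite ltr_wpDl.
have mv := ball_mass_gt0 v rt0.
rewrite -(ler_pM2r mv) -lee_fin.
have := @sum_integral_overlap _ _ _ nu X s (fun z => ball z (t / 2))
  (ball v (r + t / 2)) (cst 1%E) 1 (fun z => cara_ball _ _)
  (cara_ball _ _) ler01.
have h1 : forall z, z \in s -> ball z (t / 2) `<=` ball v (r + t / 2).
  by move=> z /sr zr; apply: ball_sub; rewrite lerD2r ltW.
have h2 : forall x, ball v (r + t / 2) x ->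
    \sum_(i <- s) \1_(ball i (t / 2)) x <= 1 :> R.
  move=> x _; elim: s seps {sr h1} => [|z s ih]; first by rewrite big_nil.
  rewrite pairwise_cons big_cons => /andP[/allP zs /ih {}ih].
  rewrite indicE; have [zx|zx] := pselect (ball z (t / 2) x); last first.
    by rewrite memNset// add0r.
  rewrite mem_set// big_seq big1 ?addr0// => y /zs zy; rewrite indicE memNset//.
  move=> /ballP yx; move/ballP: zx => zx.
  rewrite metric_sym in yx.
  have := le_lt_trans (le_trans zy (metric_triangle z x y)) (ltrD zx yx).
  by rewrite -splitr ltxx.
move=> /(_ h1 h2 (fun=> lee01) _) /=.
rewrite integral_cst; last exact: cara_ball.
rewrite mul1e mul1e => /(_ (measurable_cst _)) h.
have {}h : ((\sum_(z <- s) m z (t / 2))%:E <= (m v (r + t / 2))%:E)%E.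
  rewrite -ball_massE; apply: le_trans h.
  rewrite -sumEFin; apply: lee_sum => z _.
  rewrite integral_cst; last exact: cara_ball.
  by rewrite mul1e -ball_massE.
rewrite lee_fin in h *.
apply: (@le_trans _ _ (\sum_(z <- s) C0 ^+ k * m z (t / 2))); last first.
  by rewrite -mulr_sumr ler_wpM2l// exprn_ge0// (le_trans _ hC0).
rewrite mulr_natl -sum1_size -sumrMnr.
rewrite [leLHS]big_seq [leRHS]big_seq; apply: ler_sum => z zs; rewrite mulr1n.
apply: ball_mass_cmp => //; rewrite metric_sym.
apply: le_trans hk; rewrite mulr_natl mulr2n addrA lerD2r lerD2r ltW//.
exact: sr.
Qed.

Lemma exp2_ge (a : R) : exists k, a <= 2 ^+ k.
Proof.
exists (Num.bound a); apply: (@le_trans _ _ (Num.bound a)%:R).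
  exact/ltW/unstable.ltr_bound.
by rewrite -natrX ler_nat ltnW// ltn_expl.
Qed.

(** Doubling makes bounded sets totally bounded: a separated list of maximal
    length in [S] is a net. *)
Lemma finite_net (S : set X) (v : X) (r t : R) : S `<=` ball v r -> 0 < t ->
  exists s : seq X, [/\ pairwise (fun x y => t <= mdist x y) s,
    forall z, z \in s -> S z & forall u, S u -> exists2 z, z \in s & mdist z u < t].
Proof.
move=> Sr t0.
have [k hk] := exp2_ge ((2 * `|r| + t / 2) / (t / 2)).
have {}hk : 2 * `|r| + t / 2 <= 2 ^+ k * (t / 2).
  by rewrite -ler_pdivrMr// divr_gt0.
pose P s := pairwise (fun x y : X => t <= mdist x y) s /\
  forall z, z \in s -> S z.
pose A n := `[< exists2 s : seq X, size s = n & P s >].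
have A0 : exists n, A n.
  by exists 0%N; apply/asboolP; exists [::].
have bA n : A n -> (n <= Num.bound (C0 ^+ k))%N.
  move=> /asboolP[s <- [seps sS]]; rewrite -(ler_nat R).
  apply: le_trans (ltW (unstable.ltr_bound (C0 ^+ k))).
  apply: (size_separated t0 (normr_ge0 r) seps) => // z /sS /Sr /ballP zr.
  exact: lt_le_trans zr (ler_norm _).
case: (ex_maxnP A0 bA) => n /asboolP[s sn [seps sS]] nmax.
exists s; split => // u Su; apply: contrapT => hu.
suff : (n.+1 <= n)%N by rewrite ltnn.
apply: nmax; apply/asboolP; exists (u :: s); first by rewrite /= sn.
split; last by move=> z; rewrite inE => /predU1P[->//|/sS].
rewrite pairwise_cons seps andbT; apply/allP => z zs.
rewrite leNgt; apply/negP => uz; apply: hu; exists z => //.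
by rewrite metric_sym.
Qed.

End Doubling.
End Balls.

(** * The maximal inequality for finitely many balls *)

Section PowerInequalities.
Context (R : realType).
Implicit Types (a l p : R).

(** The increments of [t ^ p] are compared with [t] times those of
    [t ^ (p - 1)], as in an integration by parts; this amounts to Young's
    inequality for [a * l ^ (p - 1)]. *)
Lemma powR_sub_le a l p : 1 < p -> 0 <= l -> l <= a ->
  a `^ p - l `^ p <= p / (p - 1) * (a * (a `^ (p - 1) - l `^ (p - 1))).
Proof.
move=> p1 l0 la; have a0 : 0 <= a by exact: le_trans la.
have p0 : 0 < p by lra.
have pm0 : 0 < p - 1 by lra.
have q0 : 0 < p / (p - 1) by rewrite divr_gt0.
have conj : p^-1 + (p / (p - 1))^-1 = 1.
  by field; rewrite ?gt_eqF.
have := conjugate_powR a0 (powR_ge0 l (p - 1)) p0 q0 conj.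
rewrite -powRrM (_ : (p - 1) * (p / (p - 1)) = p); last first.
  by field; rewrite ?gt_eqF.
move=> h; rewrite mulrBr mulr_powRB1//.
rewrite -(ler_pM2l q0) in h.
have e : p / (p - 1) * (a `^ p / p + l `^ p / (p / (p - 1))) =
   p / (p - 1) * a `^ p - a `^ p + l `^ p.
  by field; rewrite ?gt_eqF.
rewrite e in h; rewrite mulrBr; lra.
Qed.

Local Open Scope ereal_scope.

(** Young's inequality with a parameter, by comparing [y] with [e * t]. *)
Lemma mule_powR_split (y : \bar R) (t e p : R) : (1 < p)%R -> (0 < e)%R ->
  (0 <= t)%R -> 0 <= y ->
  y * (t `^ (p - 1))%:E <= e%:E * (t `^ p)%:E + (e `^ (1 - p))%:E * y `^ p.
Proof.
move=> p1 e0 t0 y0.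
have p0 : (0 < p)%R by exact: lt_trans p1.
have pm0 : (0 < p - 1)%R by rewrite subr_gt0.
have ee0 : (0 < e `^ (1 - p))%R by apply: powR_gt0.
case: y y0 => [y||]//; last first.
  move=> _; rewrite poweRyr ?gt_eqF// gt0_muley ?lte_fin// addey ?leey//.
rewrite lee_fin => y0; rewrite poweR_EFin -!EFinM -EFinD lee_fin.
have [yt|ty] := leP y (e * t)%R.
  apply: (@le_trans _ _ (e * t `^ p)%R); last first.
    by rewrite lerDl mulr_ge0 ?powR_ge0.
  by rewrite -(mulr_powRB1 t0 p0) mulrA ler_wpM2r// powR_ge0.
apply: (@le_trans _ _ (e `^ (1 - p) * y `^ p)%R); last first.
  by rewrite lerDr mulr_ge0 ?powR_ge0// ltW.
rewrite -(mulr_powRB1 y0 p0) mulrCA ler_wpM2l//.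
have -> : (e `^ (1 - p) = (e^-1) `^ (p - 1))%R.
  by rewrite -powR_inv1 ?ltW// -powRrM; congr (_ `^ _)%R; ring.
have ei0 : (0 <= e^-1)%R by rewrite invr_ge0 ltW.
rewrite -powRM//.
apply: ge0_ler_powR; rewrite ?nnegrE ?mulr_ge0 ?(ltW pm0)//.
by rewrite mulrC ler_pdivlMr// mulrC ltW.
Qed.

End PowerInequalities.

Section FiniteMaximal.
Context (R : realType) (X : pmetricType R).
Variable mu : {outer_measure set X -> \bar R}.
Hypothesis hM : metric_measure mu.
Variable C0 : R.
Hypothesis hC0 : 1 <= C0.
Hypothesis hD : doubling mu C0.
Local Notation nu := (cara_measure mu).
Local Notation m := (ball_mass mu).
Local Notation T := (caratheodory_type mu).

Lemma outer_measure_bigsetU (I : Type) (s : seq I) (D : I -> set X) :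
  (mu (\big[setU/set0]_(i <- s) D i) <= \sum_(i <- s) mu (D i))%E.
Proof.
elim: s => [|i s ih]; first by rewrite !big_nil outer_measure0.
rewrite !big_cons; apply: le_trans (outer_measureU2 _ _ _) _.
by rewrite leeD2l.
Qed.

(** Balls are examined from the largest to the smallest, and a ball is dropped
    when it meets one that was kept. *)
Lemma vitali_sorted (s : seq (X * R)) :
  sorted (fun a b => a.2 <= b.2) s -> (forall b, b \in s -> 0 < b.2) ->
  exists s' : seq (X * R), [/\ {subset s' <= s},
    pairwise (fun a b => `[< ball a.1 a.2 `&` ball b.1 b.2 = set0 >]) s' &
    forall b, b \in s ->
      exists2 b', b' \in s' & ball b.1 b.2 `<=` ball b'.1 (3 * b'.2)].
Proof.
elim: s => [|b s ih]; first by move=> _ _; exists [::].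
move=> /= sb s0.
have bs : all (fun c => b.2 <= c.2) s.
  by apply: (order_path_min _ sb) => a c d /=; exact: le_trans.
have {ih} [c cs|s' [s's ds' cov]] := ih (path_sorted sb).
  by apply: s0; rewrite inE cs orbT.
have b0 : 0 < b.2 by apply: s0; rewrite mem_head.
have [[b' b's' [z [bz b'z]]]|nb] :=
  pselect (exists2 b', b' \in s' & ball b.1 b.2 `&` ball b'.1 b'.2 !=set0).
- exists s'; split => //; first by move=> a /s's; rewrite inE orbC => ->.
  move=> a; rewrite inE => /predU1P[->|/cov//]; exists b' => //.
  apply: ball_sub; have := allP bs b' (s's _ b's') => /= bb'.
  move/ballP : bz => bz; move/ballP : b'z => b'z; rewrite metric_sym in bz.
  have := metric_triangle b'.1 z b.1; lra.
- exists (b :: s'); split.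
  + by move=> a; rewrite !inE => /predU1P[->|/s's ->]; rewrite ?eqxx ?orbT.
  + rewrite pairwise_cons ds' andbT; apply/allP => a as'; apply/asboolP.
    by apply: contrapT => /eqP/set0P ba; apply: nb; exists a.
  + move=> a; rewrite inE => /predU1P[->|/cov[b' b's' ab']].
      exists b; first by rewrite mem_head.
      by apply: ball_sub; rewrite mdistxx; lra.
    by exists b' => //; rewrite inE b's' orbT.
Qed.

Definition ball_union (s : seq (X * R)) : set X :=
  \big[setU/set0]_(b <- s) ball b.1 b.2.

Lemma ball_unionP s x :
  ball_union s x <-> exists2 b, b \in s & ball b.1 b.2 x.
Proof.
rewrite /ball_union -bigcup_seq; split; first by move=> [b /= bs bx]; exists b.
by move=> [b bs bx]; exists b.
Qed.

Lemma ball_union_cons b s x : ball_union s x -> ball_union (b :: s) x.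
Proof. by rewrite /ball_union big_cons; right. Qed.

Lemma measurable_ball_union s : mu.-cara.-measurable (ball_union s).
Proof. by apply: bigsetU_measurable => b _; exact: (cara_ball hM). Qed.

Section FixedFunction.
Local Open Scope ereal_scope.
Variable F : X -> \bar R.
Hypothesis F0 : forall x, 0 <= F x.
Hypothesis mF : measurable_function mu F.

(** The weak type inequality keeps the integral over the union itself, which
    is what the level set argument below consumes. *)
Lemma weak_type (s : seq (X * R)) (a : R) :
  (forall b, b \in s -> (0 < b.2)%R) -> (0 <= a)%R ->
  (forall b, b \in s ->
    (a * m b.1 b.2)%:E <= \int[nu]_(x in ball b.1 b.2) F x) ->
  a%:E * mu (ball_union s) <=
    (C0 ^+ 2)%:E * \int[nu]_(x in ball_union s) F x.
Proof.
move=> s0 a0 avg.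
pose le2 := fun b c : X * R => (b.2 <= c.2)%R.
have ss : sorted le2 (sort le2 s).
  by apply: sort_sorted => b c; rewrite /le2; exact: le_total.
have [|s' [s's ds cov]] := vitali_sorted ss.
  by move=> b; rewrite mem_sort; exact: s0.
have {}s's b : b \in s' -> b \in s by move=> /s's; rewrite mem_sort.
have C00 : (0 <= C0 ^+ 2)%R by rewrite exprn_ge0// (le_trans _ hC0).
have h1 : mu (ball_union s) <= \sum_(b <- s') (C0 ^+ 2 * m b.1 b.2)%:E.
  apply: (@le_trans _ _ (mu (\big[setU/set0]_(b <- s') ball b.1 (3 * b.2)))).
    apply: le_outer_measure => x /ball_unionP[b bs bx].
    have [|b' b's' bb'] := cov b; first by rewrite mem_sort.
    by rewrite -bigcup_seq; exists b' => //; exact: bb'.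
  apply: le_trans (outer_measure_bigsetU _ _) _.
  rewrite [leLHS]big_seq [leRHS]big_seq; apply: lee_sum => b bs.
  have b0 := s0 _ (s's _ bs).
  rewrite ball_massE// lee_fin; apply: (ball_mass_cmp hM hC0 hD) => //.
  by rewrite mdistxx; lra.
apply: (le_trans (lee_wpmul2l _ h1)); first by rewrite lee_fin.
rewrite sumEFin -EFinM -mulr_sumr mulrCA EFinM lee_wpmul2l ?lee_fin//.
have := @sum_integral_overlap _ _ _ nu _ s' (fun b => ball b.1 b.2)
  (ball_union s) F 1 (fun b => cara_ball hM _ _)
  (measurable_ball_union _) ler01.
move=> /(_ _ _ F0 mF); rewrite mul1e => h; apply: le_trans (h _ _); last 2 first.
- by move=> b /s's bs x bx; apply/ball_unionP; exists b.
- move=> x _; elim: s' ds {s's cov h1 h} => [|b s1 ih]; first by rewrite big_nil.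
  rewrite pairwise_cons big_cons => /andP[/allP zs /ih {}ih].
  rewrite indicE; have [zx|zx] := pselect (ball b.1 b.2 x); last first.
    by rewrite memNset// add0r.
  rewrite mem_set// big_seq big1 ?addr0// => y /zs /asboolP zy.
  rewrite indicE memNset// => yx.
  by have : (ball b.1 b.2 `&` ball y.1 y.2) x by []; rewrite zy.
- rewrite mulr_sumr -sumEFin [leLHS]big_seq [leRHS]big_seq.
  by apply: lee_sum => b /s's; exact: avg.
Qed.

Variable A : X * R -> R.

(** For a list sorted by increasing [A], this is the largest value of [A] at a
    ball containing [x], or [l] if there is none. *)
Fixpoint top_value (l : R) (s : seq (X * R)) (x : X) : R :=
  if s is b :: s' then
    if x \in ball_union (b :: s') then top_value (A b) s' x else l
  else l.

Lemma top_value_out l s x : ~ ball_union s x -> top_value l s x = l.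
Proof. by case: s => //= b s h; rewrite memNset. Qed.

(** One layer of the layer cake decomposition of [phi (top_value l s)]. *)
Lemma top_value_cons (phi : R -> R) l b s x :
  (phi (top_value l (b :: s) x) - phi l =
   \1_(ball_union (b :: s)) x * (phi (A b) - phi l) +
   (phi (top_value (A b) s x) - phi (A b)))%R.
Proof.
rewrite /= indicE; have [h|h] := pselect (ball_union (b :: s) x).
  by rewrite mem_set//= mul1r; ring.
rewrite memNset//= mul0r top_value_out; first by rewrite !subrr addr0.
by move=> /(ball_union_cons b).
Qed.

Lemma measurable_top_value l s : measurable_fun [set: T] (top_value l s).
Proof.
elim: s l => [|b s ih] l; first exact: measurable_cst.
have -> : top_value l (b :: s) = (fun x => l +
    (\1_(ball_union (b :: s)) x * (A b - l) + (top_value (A b) s x - A b)))%R.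
  by apply/funext => x; rewrite -(top_value_cons id); ring.
apply: measurable_funD; first exact: measurable_cst.
apply: measurable_funD; last by apply: measurable_funB.
apply: measurable_funM => //; apply: measurable_indic.
exact: measurable_ball_union.
Qed.

Let leA := fun b c : X * R => (A b <= A c)%R.

Lemma sorted_all b s : sorted leA (b :: s) ->
  sorted leA s /\ forall c, c \in s -> (A b <= A c)%R.
Proof.
move=> /= sb; split; first exact: path_sorted sb.
by apply/allP; apply: (order_path_min _ sb) => a c d; exact: le_trans.
Qed.

Lemma top_value_ge l s x : sorted leA s ->
  (forall c, c \in s -> (l <= A c)%R) -> (l <= top_value l s x)%R.
Proof.
elim: s l => [|b s ih] l //= sb hl; case: ifP => // _.
have [ss hs] := sorted_all sb.
by apply: le_trans (ih _ ss hs); apply: hl; rewrite mem_head.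
Qed.

Lemma top_value_sup l s b x : sorted leA s -> b \in s -> ball b.1 b.2 x ->
  (A b <= top_value l s x)%R.
Proof.
elim: s l => [|c s ih] l //= sb bs bx.
rewrite mem_set; last by apply/ball_unionP; exists b.
have [ss hs] := sorted_all sb.
move: bs; rewrite inE => /predU1P[->|bs]; last exact: ih.
exact: top_value_ge.
Qed.

Lemma top_value_le M l s x : (l <= M)%R -> (forall c, c \in s -> (A c <= M)%R) ->
  (top_value l s x <= M)%R.
Proof.
elim: s l => [|b s ih] l //= lM sM; case: ifP => // _.
apply: ih => [|c cs]; first by apply: sM; rewrite mem_head.
by apply: sM; rewrite inE cs orbT.
Qed.

(** This is Doob's argument.  Raising the level from [l] to the smallest average
    [A b] changes both sides by a multiple of the indicator of the union of all
    remaining balls, on which the weak type inequality compares them. *)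
Lemma top_value_doob (p l : R) s : (1 < p)%R -> (0 <= l)%R -> sorted leA s ->
  (forall b, b \in s -> (l <= A b)%R) ->
  (forall b, b \in s -> (0 < b.2)%R) ->
  (forall b, b \in s ->
    (A b * m b.1 b.2)%:E <= \int[nu]_(x in ball b.1 b.2) F x) ->
  \int[nu]_x (top_value l s x `^ p - l `^ p)%:E <=
  (C0 ^+ 2 * (p / (p - 1)))%:E *
    \int[nu]_x (F x * (top_value l s x `^ (p - 1) - l `^ (p - 1))%:E).
Proof.
move=> p1; have p0 : (0 < p)%R by exact: lt_trans p1.
have pm0 : (0 < p - 1)%R by rewrite subr_gt0.
have pp0 : (0 <= p / (p - 1))%R by rewrite divr_ge0 ?ltW.
have K0 : (0 <= C0 ^+ 2 * (p / (p - 1)))%R.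
  by rewrite mulr_ge0// exprn_ge0// (le_trans _ hC0).
elim: s l => [|b s ih] l l0 sb hl s0 avg.
  rewrite /= integral0_eq; last by move=> x _; rewrite subrr.
  by apply: mule_ge0 => //; apply: integral_ge0 => x _; rewrite subrr mule0.
have [ss hs] := sorted_all sb.
have lb : (l <= A b)%R by apply: hl; rewrite mem_head.
have b0 : (0 <= A b)%R by exact: le_trans lb.
set U := ball_union (b :: s).
have mU : mu.-cara.-measurable U := measurable_ball_union _.
have mtop q : measurable_fun [set: T]
    (fun x => (top_value (A b) s x `^ q - A b `^ q)%:E).
  apply/measurable_EFinP; apply: measurable_funB => //.
  apply: (@measurableT_comp _ _ _ _ _ _ (fun t => t `^ q)%R) => //.
  exact: measurable_top_value.
have topge (q : R) x : (0 <= q)%R ->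
    (0 <= top_value (A b) s x `^ q - A b `^ q)%R.
  move=> q0; rewrite subr_ge0; have := top_value_ge x ss hs => h.
  by apply: ge0_ler_powR; rewrite ?nnegrE// (le_trans b0 h).
have levge (q : R) : (0 <= q)%R -> (0 <= A b `^ q - l `^ q)%R.
  by move=> q0; rewrite subr_ge0; apply: ge0_ler_powR; rewrite ?nnegrE.
have step1 : \int[nu]_x (top_value l (b :: s) x `^ p - l `^ p)%:E =
    (A b `^ p - l `^ p)%:E * mu U +
    \int[nu]_x (top_value (A b) s x `^ p - A b `^ p)%:E.
  under eq_integral do
    rewrite (top_value_cons (fun t => t `^ p)%R) EFinD mulrC EFinM.
  rewrite ge0_integralD//; first last.
  - by move=> x _; rewrite lee_fin topge// ltW.
  - apply: measurable_funeM; apply/measurable_EFinP; exact: measurable_indic.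
  - by move=> x _; apply: mule_ge0; rewrite lee_fin// levge// ltW.
  rewrite ge0_integralZl//; first last.
  - by rewrite lee_fin levge// ltW.
  - by apply/measurable_EFinP; exact: measurable_indic.
  by rewrite integral_indic// setIT.
have step2 : \int[nu]_x (F x * (top_value l (b :: s) x `^ (p - 1)
      - l `^ (p - 1))%:E) =
    (A b `^ (p - 1) - l `^ (p - 1))%:E * \int[nu]_(x in U) F x +
    \int[nu]_x (F x * (top_value (A b) s x `^ (p - 1) - A b `^ (p - 1))%:E).
  rewrite (eq_integral (fun x : T => (A b `^ (p - 1) - l `^ (p - 1))%:E * (F \_ U) x +
    F x * (top_value (A b) s x `^ (p - 1) - A b `^ (p - 1))%:E)); last first.
    move=> x _; rewrite (top_value_cons (fun t => t `^ (p - 1))%R) EFinD.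
    rewrite ge0_muleDr; last 2 first.
    - by rewrite lee_fin mulr_ge0// levge// ltW.
    - by rewrite lee_fin topge// ltW.
    congr (_ + _); rewrite /patch indicE -/U; case: (x \in U).
      by rewrite mul1r muleC.
    by rewrite mul0r !mule0.
  have mFU : measurable_fun [set: T] (F \_ U).
    exact: (measurable_erestrict mU mF).
  have FU0 x : 0 <= (F \_ U) x by apply: erestrict_ge0.
  rewrite ge0_integralD//; first last.
  - exact: emeasurable_funM.
  - by move=> x _; apply: mule_ge0 => //; rewrite lee_fin topge// ltW.
  - exact: measurable_funeM.
  - by move=> x _; apply: mule_ge0 => //; rewrite lee_fin levge// ltW.
  rewrite ge0_integralZl//; first by rewrite [in RHS]integral_mkcond.
  by rewrite lee_fin levge// ltW.
rewrite step1 step2 ge0_muleDr; last 2 first.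
- apply: mule_ge0; last exact: integral_ge0.
  by rewrite lee_fin levge// ltW.
- by apply: integral_ge0 => x _; apply: mule_ge0 => //; rewrite lee_fin topge// ltW.
apply: leeD; last first.
  apply: ih => //.
  - by move=> c cs; apply: s0; rewrite inE cs orbT.
  - by move=> c cs; apply: avg; rewrite inE cs orbT.
have weak : (A b)%:E * mu U <= (C0 ^+ 2)%:E * \int[nu]_(x in U) F x.
  apply: weak_type => // c cs; apply: le_trans (avg _ cs).
  rewrite lee_fin ler_wpM2r ?ball_mass_ge0//.
  by move: cs; rewrite inE => /predU1P[->|/hs].
apply: (@le_trans _ _ ((p / (p - 1) * (A b `^ (p - 1) - l `^ (p - 1)))%:E *
    ((A b)%:E * mu U))).
  rewrite muleA lee_wpmul2r ?outer_measure_ge0// -EFinM lee_fin.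
  by apply: le_trans (powR_sub_le p1 l0 lb) _; rewrite (mulrC (A b)) mulrA.
apply: (@le_trans _ _ ((p / (p - 1) * (A b `^ (p - 1) - l `^ (p - 1)))%:E *
    ((C0 ^+ 2)%:E * \int[nu]_(x in U) F x))).
  by rewrite lee_wpmul2l// lee_fin mulr_ge0// levge// ltW.
rewrite !muleA lee_wpmul2r ?integral_ge0//.
rewrite -!EFinM lee_fin; set u := (p / (p - 1))%R; set v := (_ - _)%R.
by have -> : (u * v * C0 ^+ 2 = C0 ^+ 2 * u * v)%R by ring.
Qed.

(** Young's inequality splits the right-hand side of [top_value_doob] and leaves
    half of the left-hand side, which can be absorbed: it is finite, because
    [top_value] is bounded and vanishes off a set of finite mass. *)
Lemma top_value_strong (p : R) s : (1 < p)%R -> sorted leA s ->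
  (forall b, b \in s -> (0 <= A b)%R) ->
  (forall b, b \in s -> (0 < b.2)%R) ->
  (forall b, b \in s ->
    (A b * m b.1 b.2)%:E <= \int[nu]_(x in ball b.1 b.2) F x) ->
  \int[nu]_x (top_value 0 s x `^ p)%:E <=
  ((2 * (C0 ^+ 2 * (p / (p - 1)))) `^ p)%:E * \int[nu]_x (F x `^ p).
Proof.
move=> p1 ss A0 s0 avg.
have p0 : (0 < p)%R by exact: lt_trans p1.
have pm0 : (0 < p - 1)%R by rewrite subr_gt0.
set K := (C0 ^+ 2 * (p / (p - 1)))%R.
have K0 : (0 < K)%R.
  by rewrite mulr_gt0 ?divr_gt0// exprn_gt0// (lt_le_trans _ hC0).
have t0 x : (0 <= top_value 0 s x)%R by exact: top_value_ge.
have mt q : measurable_fun [set: T] (fun x => (top_value 0 s x `^ q)%:E).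
  apply/measurable_EFinP.
  apply: (@measurableT_comp _ _ _ _ _ _ (fun t => t `^ q)%R) => //.
  exact: measurable_top_value.
have mFp : measurable_fun [set: T] (fun x => F x `^ p).
  exact: (measurableT_comp (measurable_poweR p) mF).
have := top_value_doob p1 (lexx 0%R) ss A0 s0 avg.
rewrite !powR0 ?gt_eqF//; under eq_integral do rewrite subr0.
under [X in _ * X]eq_integral do rewrite subr0.
rewrite -/K => doob.
set I := \int[nu]_x (top_value 0 s x `^ p)%:E in doob *.
set J := \int[nu]_x (F x `^ p).
have I0 : 0 <= I by apply: integral_ge0 => x _; rewrite lee_fin powR_ge0.
have J0 : 0 <= J by apply: integral_ge0 => x _; rewrite poweR_ge0.
have Ifin : I \is a fin_num.
  rewrite ge0_fin_numE//.
  pose M := (\sum_(b <- s) A b)%R.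
  have sM b : b \in s -> (A b <= M)%R.
    move=> bs; rewrite /M (big_rem b)//= lerDl big_seq sumr_ge0// => c.
    by move=> /mem_rem; exact: A0.
  have M0 : (0 <= M)%R by rewrite /M big_seq sumr_ge0.
  apply: (@le_lt_trans _ _ (\int[nu]_(x in ball_union s) (cst (M `^ p)%:E) x)).
    rewrite [leRHS]integral_mkcond; apply: ge0_le_integral_fun => x _.
      by rewrite lee_fin powR_ge0.
    rewrite /patch; have [xs|xs] := pselect (ball_union s x).
      rewrite mem_set// lee_fin; apply: ge0_ler_powR; rewrite ?nnegrE//.
        exact: ltW.
      exact: top_value_le.
    by rewrite memNset// top_value_out// powR0// gt_eqF.
  rewrite integral_cst; last exact: measurable_ball_union.
  apply: lte_mul_pinfty; rewrite ?lee_fin ?powR_ge0//.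
  apply: le_lt_trans (outer_measure_bigsetU _ _) _.
  under eq_bigr do rewrite ball_massE//.
  by rewrite sumEFin ltry.
have e0 : (0 < (2 * K)^-1)%R by rewrite invr_gt0 mulr_gt0.
have h : I <= K%:E * ((2 * K)^-1%:E * I + ((2 * K)^-1 `^ (1 - p))%:E * J).
  apply: (le_trans doob); rewrite lee_wpmul2l ?lee_fin ?(ltW K0)//.
  rewrite -ge0_integralZl//; last 2 first.
  - by move=> x _; rewrite lee_fin powR_ge0.
  - by rewrite lee_fin ltW.
  rewrite -ge0_integralZl//; last 2 first.
  - by move=> x _; rewrite poweR_ge0.
  - by rewrite lee_fin powR_ge0.
  rewrite -ge0_integralD//; first last.
  - exact: measurable_funeM.
  - by move=> x _; apply: mule_ge0; rewrite ?lee_fin ?powR_ge0 ?poweR_ge0.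
  - exact: measurable_funeM.
  - by move=> x _; apply: mule_ge0; rewrite ?lee_fin ?powR_ge0 ?(ltW e0).
  apply: ge0_le_integral_fun => x _.
    by apply: mule_ge0; rewrite ?lee_fin ?powR_ge0.
  exact: mule_powR_split.
have [Jy|Jfin] := eqVneq J +oo.
  by rewrite Jy gt0_muley ?leey// lte_fin powR_gt0// mulr_gt0.
have {}Jfin : J \is a fin_num by rewrite ge0_fin_numE// lt_neqAle Jfin leey.
move: h; rewrite -(fineK Ifin) -(fineK Jfin) -[(_ * _ + _ * _)%E]/((_ + _)%R%:E).
rewrite -!EFinM !lee_fin.
rewrite mulrDr mulrA (_ : K * (2 * K)^-1 = 2^-1)%R; last first.
  by field; rewrite gt_eqF.
have K20 : (0 <= 2 * K)%R by rewrite mulr_ge0 ?(ltW K0).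
have -> : ((2 * K)^-1 `^ (1 - p) = (2 * K) `^ (p - 1))%R.
  by rewrite -(powR_inv1 K20) -powRrM; congr (_ `^ _)%R; ring.
rewrite -(mulr_powRB1 K20 p0).
lra.
Qed.

End FixedFunction.
End FiniteMaximal.

(** * The maximal function *)

Lemma ge0_le_poweR (R : realType) (x y : \bar R) (r : R) : 0 <= r ->
  (0 <= x -> x <= y -> x `^ r <= y `^ r)%E.
Proof.
move=> r0 x0 xy; apply: gt0_ler_poweR => //; rewrite in_itv/= leey andbT//.
exact: le_trans xy.
Qed.

Section MaximalFunction.
Context (R : realType) (X : pmetricType R).
Variable mu : {outer_measure set X -> \bar R}.
Hypothesis hM : metric_measure mu.
Local Notation nu := (cara_measure mu).
Local Notation m := (ball_mass mu).
Local Notation T := (caratheodory_type mu).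

Section LowerSemicontinuity.
Import numFieldNormedType.Exports.
Local Open Scope ereal_scope.
Variables (alpha : R) (f : X -> \bar R).
Hypotheses (alpha0 : (0 <= alpha)%R) (mf : measurable_function mu f).

Lemma cvg_ball_integral (x : X) (rho : R) : (0 < rho)%R ->
  (fun n => ((rho - rho / 2 * n.+1%:R^-1) `^ alpha)%:E *
    \int[nu]_(y in ball x (rho - rho / 2 * n.+1%:R^-1)%R) `|f y|) @ \oo
    --> (rho `^ alpha)%:E * \int[nu]_(y in ball x rho) `|f y|.
Proof.
move=> rho0.
have rn : (rho - rho / 2 * n.+1%:R^-1)%R @[n --> \oo] --> rho.
  rewrite -[X in _ --> X]subr0; apply: cvgB; first exact: cvg_cst.
  rewrite -[X in _ --> X](mulr0 (rho / 2)%R); apply: cvgM; first exact: cvg_cst.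
  exact: cvg_harmonic.
have mabs D : measurable_fun (D : set T) (fun y => `|f y|).
  exact/measurable_funTS/(measurableT_comp (@abse_measurable _ _) mf).
apply: cvgeM.
- by rewrite mule_defE eqe gt_eqF ?powR_gt0//= andbF.
- apply: cvg_EFin; first exact: nearW.
  apply: (@continuous_cvg _ _ _ _ _ _ (fun t : R => t `^ alpha)%R) => //.
  apply/differentiable_continuous/derivable1_diffP; apply: derivable_powR.
  by rewrite in_itv/= andbT.
- have := @ge0_nondecreasing_set_cvg_integral _ T R
    (fun n => ball x (rho - rho / 2 * n.+1%:R^-1)%R : set T)
    (fun y => `|f y|) nu.
  rewrite (_ : \bigcup_i _ = ball x rho); last first.
    apply/seteqP; split=> [y [n _ /ballP xy]|y /ballP xy].
      apply/ballP; apply: (lt_le_trans xy); rewrite gerBl mulr_ge0//.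
      by rewrite divr_ge0// ltW.
    have /cvgrPdist_lt/(_ (rho - mdist x y)%R) := rn.
    rewrite subr_gt0 xy => /(_ isT)[n _ /(_ n (leqnn n))/=] h.
    exists n => //; apply/ballP; move: h; rewrite opprB addrC subrK.
    by move=> /(le_lt_trans (ler_norm _)); rewrite ltrBrDl ltrBrDr.
  apply => //.
  + move=> i j ij; rewrite subsetEset; apply: ball_sub; rewrite mdistxx add0r.
    rewrite lerD2l lerN2 ler_wpM2l ?divr_ge0 ?(ltW rho0)//.
    by rewrite lef_pV2 ?posrE// ler_nat.
  + by move=> i; exact: cara_ball.
Qed.

(** Shrinking the radius a little loses little of the integral, and the shrunk
    balls around all nearby centres stay inside the original ball: no continuity
    of the mass in the radius is involved. *)
Lemma open_fractional_maximal (lam : R) :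
  open [set x : X | lam%:E < fractional_maximal mu alpha f x].
Proof.
rewrite openE => x /= /ereal_sup_gt[_ [rho /= rho0 <-]].
have m0 := ball_mass_gt0 hM x rho0.
set I := \int[nu]_(y in ball x rho) `|f y|.
rewrite -/(m x rho) mulrC EFinM -muleA lte_pdivlMl// => lamI.
pose r n := (rho - rho / 2 * n.+1%:R^-1)%R.
have [n hn] : exists n, (m x rho)%:E * lam%:E <
    (r n `^ alpha)%:E * \int[nu]_(y in ball x (r n)) `|f y|.
  apply: contrapT => /forallNP h.
  suff : (rho `^ alpha)%:E * I <= (m x rho)%:E * lam%:E.
    by rewrite leNgt lamI.
  rewrite -(cvg_lim (@ereal_hausdorff R) (@cvg_ball_integral x rho rho0)).
  apply: lime_le; first by apply/cvg_ex; eexists; exact: cvg_ball_integral.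
  apply: nearW => n; by rewrite leNgt; apply/negP; exact: h.
have rhon : (0 < rho / 2 * n.+1%:R^-1 <= rho / 2)%R.
  rewrite mulr_gt0 ?divr_gt0 ?invr_gt0//= ler_piMr ?divr_ge0 ?(ltW rho0)//.
  by rewrite invf_le1// ler1n.
pose t := (rho / 2 * n.+1%:R^-1)%R.
have rE : r n = (rho - t)%R by [].
have {rhon} [t0 t1] : (0 < t)%R /\ (t <= rho / 2)%R by apply/andP.
pose delta := (t / 2)%R.
have delta0 : (0 < delta)%R by rewrite /delta; lra.
have rn0 : (0 < r n)%R by rewrite rE; lra.
apply/nbhs_ballP; exists delta => // y /ballP xy /=.
have rd0 : (0 < rho - delta)%R by rewrite /delta; lra.
have my0 := ball_mass_gt0 hM y rd0.
apply: (@lt_le_trans _ _ (((rho - delta) `^ alpha / m y (rho - delta))%:E *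
    \int[nu]_(z in ball y (rho - delta)%R) `|f z|)); last first.
  by apply: ereal_sup_ubound; exists (rho - delta)%R.
rewrite mulrC EFinM -muleA lte_pdivlMl//.
have [lam0|lam0] := ltP lam 0%R.
  apply: (@lt_le_trans _ _ 0).
    by rewrite -EFinM lte_fin pmulr_rlt0.
  by apply: mule_ge0; [rewrite lee_fin powR_ge0|exact: integral_ge0].
apply: (@le_lt_trans _ _ ((m x rho)%:E * lam%:E)).
  rewrite -!EFinM lee_fin ler_wpM2r//; apply: ball_mass_le => //.
  by rewrite /delta in xy *; lra.
apply: (lt_le_trans hn); apply: lee_pmul.
- by rewrite lee_fin powR_ge0.
- exact: integral_ge0.
- rewrite lee_fin; apply: ge0_ler_powR; rewrite ?nnegrE ?(ltW rn0) ?(ltW rd0)//.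
  by rewrite rE /delta; lra.
- apply: ge0_le_integral_set => //; apply: ball_sub; rewrite metric_sym rE.
  by rewrite /delta in xy *; lra.
Qed.

Lemma measurable_fractional_maximal :
  measurable_function mu (fractional_maximal mu alpha f).
Proof.
apply: (measurability _ (ErealGenOInfty.measurableE R)) => // _ [_ [lam ->] <-].
rewrite setTI preimage_itvoy; apply: (open_cara hM).
exact: open_fractional_maximal.
Qed.

End LowerSemicontinuity.

Lemma fractional_maximal_ge0 alpha f x : (0 <= fractional_maximal mu alpha f x)%E.
Proof.
apply: le_ereal_sup_tmp; eexists; first by exists 1 => /=.
by apply: mule_ge0; [rewrite lee_fin divr_ge0 ?powR_ge0 ?ball_mass_ge0
  |exact: integral_ge0].
Qed.

Lemma fractional_maximal_le alpha f x (M : \bar R) :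
  (forall r, 0 < r ->
    ((r `^ alpha / m x r)%:E * \int[nu]_(y in ball x r) `|f y| <= M)%E) ->
  (fractional_maximal mu alpha f x <= M)%E.
Proof. by move=> h; apply: ge_ereal_sup => _ [r /= r0 <-]; exact: h. Qed.

Lemma fractional_maximal_ge alpha f x r : 0 < r ->
  ((r `^ alpha / m x r)%:E * \int[nu]_(y in ball x r) `|f y| <=
    fractional_maximal mu alpha f x)%E.
Proof. by move=> r0; apply: ereal_sup_ubound; exists r. Qed.

Variable C0 : R.
Hypothesis hC0 : 1 <= C0.
Hypothesis hD : doubling mu C0.

(** Nets at rational scales in the balls around a fixed point provide the
    centres: the maximal function is then a supremum of countably many
    multiples of indicators of balls. *)
Lemma dense_balls : exists beta : nat -> X * R,
  (forall n, 0 < (beta n).2) /\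
  forall x r, 0 < r -> exists2 n, ball x r `<=` ball (beta n).1 (beta n).2 &
    m (beta n).1 (beta n).2 <= C0 ^+ 3 * m x r.
Proof.
have net (qn : rat * nat) : exists s : seq X, 0 < ratr qn.1 :> R ->
    forall u, ball (point : X) qn.2%:R u -> exists2 z, z \in s & mdist z u < ratr qn.1.
  case: (ltP 0 (ratr qn.1 : R)) => [q0|]; last by exists [::].
  have [s [_ _ hs]] := finite_net hM hC0 hD
    (@subset_refl _ (ball (point : X) qn.2%:R)) q0.
  by exists s.
have [N hN] := choice net.
pose beta n : X * R :=
  if unpickle n is Some (q, k, i) then
    if 0 < ratr q :> R then (nth point (N (q, k)) i, 2 * ratr q) else (point, 1)
  else (point, 1).
exists beta; split.
  move=> n; rewrite /beta; case: unpickle => [[[q k] i]|]//=.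
  by case: ifP => //= q0; rewrite mulr_gt0.
move=> x r r0.
have r2r : r < 2 * r by lra.
have [q /itvP hq] := rat_in_itvoo r2r.
have rq : r < ratr q by rewrite hq.
have qr : ratr q < 2 * r by rewrite hq.
have q0 : 0 < ratr q :> R by lra.
pose k := Num.bound (mdist point x).
have [|z zN zx] := hN (q, k) q0 x.
  by apply/ballP; exact: unstable.ltr_bound.
have be : beta (pickle (q, k, index z (N (q, k)))) = (z, 2 * ratr q).
  by rewrite /beta pickleK q0 nth_index.
exists (pickle (q, k, index z (N (q, k)))); rewrite be /=.
  by apply: ball_sub; rewrite /= in zx; lra.
apply: (ball_mass_cmp hM hC0 hD r0); rewrite metric_sym.
by rewrite /= in zx; lra.
Qed.

Definition maximal_const (p : R) : R :=
  (C0 ^+ 3) `^ p * (2 * (C0 ^+ 2 * (p / (p - 1)))) `^ p.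

Lemma maximal_const_gt0 p : 1 < p -> 0 < maximal_const p.
Proof.
move=> p1; have C00 : 0 < C0 by exact: lt_le_trans hC0.
have pm0 : 0 < p - 1 by rewrite subr_gt0.
rewrite /maximal_const mulr_gt0// powR_gt0 ?exprn_gt0//.
by rewrite !mulr_gt0 ?invr_gt0 ?exprn_gt0//; lra.
Qed.

Local Open Scope ereal_scope.

(** The Hardy-Littlewood maximal theorem: the maximal functions of the first [n]
    balls of [dense_balls] satisfy it with one constant and increase to a function
    comparable with the full maximal function. *)
Lemma maximal_strong (p : R) (f : X -> \bar R) : (1 < p)%R ->
  measurable_function mu f ->
  \int[nu]_x (fractional_maximal mu 0 f x `^ p) <=
  (maximal_const p)%:E * \int[nu]_x (`|f x| `^ p).
Proof.
move=> p1 mf; have p0 : (0 < p)%R by exact: lt_trans p1.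
set J := \int[nu]_x (`|f x| `^ p).
have J0 : 0 <= J by apply: integral_ge0 => x _; exact: poweR_ge0.
have [->|Jy] := eqVneq J +oo.
  by rewrite gt0_muley ?leey// lte_fin maximal_const_gt0.
have {}Jy : J < +oo by rewrite lt_neqAle Jy leey.
have mabs : measurable_function mu (fun x => `|f x|).
  exact: (measurableT_comp (@abse_measurable _ _) mf).
have finite_int x r : \int[nu]_(y in ball x r) `|f y| \is a fin_num.
  rewrite ge0_fin_numE ?integral_ge0//.
  apply: (@le_lt_trans _ _ (\int[nu]_(y in ball x r) (1 + `|f y| `^ p))).
    apply: ge0_le_integral_fun => // y _.
    have := abse_ge0 (f y); case: `|f y| => [t||]//; last first.
      by rewrite poweRyr ?gt_eqF// addey.
    rewrite lee_fin => t0; rewrite poweR_EFin -EFinD lee_fin.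
    have [t1|t1] := leP t 1%R; first by rewrite ler_wpDr ?powR_ge0.
    by rewrite ler_wpDl// le1r_powR// ltW.
  rewrite ge0_integralD//; first last.
  - exact/measurable_funTS/(measurableT_comp (measurable_poweR p) mabs).
  - by move=> y _; exact: poweR_ge0.
  - exact: cara_ball.
  rewrite integral_cst; last exact: cara_ball.
  rewrite mul1e cara_ball_massE// lte_add_pinfty// ?ltry//.
  apply: le_lt_trans Jy; apply: ge0_le_integral_set => // y _.
  exact: poweR_ge0.
have [beta [beta0 hbeta]] := dense_balls.
pose A (b : X * R) := (fine (\int[nu]_(y in ball b.1 b.2) `|f y|) / m b.1 b.2)%R.
have AE b : (0 < b.2)%R ->
    (A b * m b.1 b.2)%:E = \int[nu]_(y in ball b.1 b.2) `|f y|.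
  move=> b0; rewrite /A divfK ?fineK// gt_eqF//; exact: ball_mass_gt0.
have A0 b : (0 <= A b)%R.
  by rewrite divr_ge0 ?ball_mass_ge0// fine_ge0// integral_ge0.
pose G := fix G n x : R := if n is k.+1 then
  Order.max (G k x) (A (beta k) * \1_(ball (beta k).1 (beta k).2) x)%R else 0%R.
have G0 n x : (0 <= G n x)%R.
  by elim: n => //= n ih; rewrite le_max ih.
have mG n : measurable_fun [set: T] (G n).
  elim: n => [|n ih]; first exact: measurable_cst.
  apply: measurable_maxr => //; apply: measurable_funM => //.
  apply: measurable_indic; exact: cara_ball.
have mGp n : measurable_fun [set: T] (fun x => (G n x `^ p)%:E).
  apply/measurable_EFinP.
  exact: (@measurableT_comp _ _ _ _ _ _ (fun t => t `^ p)%R).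
have ndG x : nondecreasing_seq (fun n => (G n x `^ p)%:E).
  apply/nondecreasing_seqP => n; rewrite lee_fin.
  have h : (G n x <= G n.+1 x)%R by rewrite /= le_max lexx.
  by apply: ge0_ler_powR; rewrite ?nnegrE ?G0 ?(ltW p0).
have Gp0 n x : 0 <= (G n x `^ p)%:E by rewrite lee_fin powR_ge0.
pose le_avg := fun b c : X * R => (A b <= A c)%R.
have intG n : \int[nu]_x (G n x `^ p)%:E <=
    ((2 * (C0 ^+ 2 * (p / (p - 1)))) `^ p)%:E * J.
  pose s := sort le_avg [seq beta i | i <- iota 0 n].
  have ss : sorted le_avg s.
    by apply: sort_sorted => b c; rewrite /le_avg; exact: le_total.
  have sP b : b \in s -> (0 < b.2)%R.
    by rewrite mem_sort => /mapP[i _ ->].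
  have mem_s i : (i < n)%N -> beta i \in s.
    by move=> ni; rewrite mem_sort map_f// mem_iota.
  have strong := @top_value_strong _ _ _ hM _ hC0 hD (fun x => `|f x|)
    (fun=> abse_ge0 _) mabs A p s p1 ss.
  apply: le_trans (strong _ sP _) => //; last by move=> b /sP /AE ->.
  apply: ge0_le_integral_fun => // x _; rewrite lee_fin.
  have Gtop k : (k <= n)%N -> (G k x <= top_value A 0 s x)%R.
    elim: k => [|k ih] kn /=; first by apply: top_value_ge.
    rewrite ge_max ih ?(ltnW kn)//= indicE.
    have [bx|bx] := pselect (ball (beta k).1 (beta k).2 x).
      by rewrite mem_set// mulr1; apply: top_value_sup => //; exact: mem_s.
    by rewrite memNset// mulr0; apply: top_value_ge.
  have h := Gtop _ (leqnn n).
  apply: ge0_ler_powR; rewrite ?nnegrE ?(ltW p0)//.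
  exact: le_trans h.
have C00 : (0 <= C0 ^+ 3)%R by rewrite exprn_ge0// (le_trans _ hC0).
have step x : fractional_maximal mu 0 f x `^ p <=
    ((C0 ^+ 3) `^ p)%:E * limn (fun n => (G n x `^ p)%:E).
  set L := limn _.
  have GL n : (G n x `^ p)%:E <= L.
    rewrite /L (cvg_lim (@ereal_hausdorff R) (ereal_nondecreasing_cvgn (ndG x))).
    by apply: ereal_sup_ubound; exists n.
  have L0 : 0 <= L by apply: le_trans (GL 0%N).
  have CL0 : 0 <= ((C0 ^+ 3) `^ p)%:E * L.
    by apply: mule_ge0 => //; rewrite lee_fin powR_ge0.
  have Lp0 : 0 <= (C0 ^+ 3)%:E * L `^ p^-1.
    by apply: mule_ge0; rewrite ?lee_fin ?poweR_ge0.
  have -> : ((C0 ^+ 3) `^ p)%:E * L = ((C0 ^+ 3)%:E * L `^ p^-1) `^ p.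
    rewrite poweRM ?lee_fin ?poweR_ge0// -poweRrM mulVf ?gt_eqF// poweRe1//.
  apply: ge0_le_poweR; rewrite ?(ltW p0) ?fractional_maximal_ge0//.
  apply: fractional_maximal_le => r r0; rewrite powRr0.
  have [n bn mn] := hbeta x r r0.
  have m0 := ball_mass_gt0 hM x r0.
  have mb0 := ball_mass_gt0 hM (beta n).1 (beta0 n).
  apply: (@le_trans _ _ (C0 ^+ 3 * A (beta n))%:E).
    rewrite mul1r lee_pdivrMl// -EFinM.
    apply: (@le_trans _ _ (\int[nu]_(y in ball (beta n).1 (beta n).2) `|f y|)).
      exact: ge0_le_integral_set.
    rewrite -AE// lee_fin.
    have -> : (m x r * (C0 ^+ 3 * A (beta n)) = A (beta n) * (C0 ^+ 3 * m x r))%R.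
      by ring.
    by rewrite ler_wpM2l.
  have AG : (A (beta n) <= G n.+1 x)%R.
    rewrite /= indicE mem_set; last first.
      by apply: bn; apply/ballP; rewrite mdistxx.
    by rewrite mulr1 le_max lexx orbT.
  rewrite EFinM lee_wpmul2l ?lee_fin//.
  apply: (@le_trans _ _ (G n.+1 x)%:E); first by rewrite lee_fin.
  have -> : (G n.+1 x)%:E = (G n.+1 x `^ p)%:E `^ p^-1.
    by rewrite poweR_EFin -powRrM mulfV ?gt_eqF// powRr1.
  by apply: ge0_le_poweR; rewrite ?invr_ge0 ?(ltW p0).
apply: (le_trans (ge0_le_integral_fun nu _ (fun x _ => step x))).
  by move=> x _; exact: poweR_ge0.
have L0 x : 0 <= limn (fun n => (G n x `^ p)%:E).
  apply: lime_ge; first exact: ereal_nondecreasing_is_cvgn.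
  exact: nearW.
have mL : measurable_fun [set: T] (fun x => limn (fun n => (G n x `^ p)%:E)).
  apply: (emeasurable_fun_cvg _ _ mGp) => x _.
  exact: ereal_nondecreasing_is_cvgn.
rewrite ge0_integralZl//; last by rewrite lee_fin powR_ge0.
rewrite /maximal_const EFinM -muleA lee_wpmul2l ?lee_fin ?powR_ge0//.
rewrite (monotone_convergence nu measurableT mGp)//.
apply: lime_le; last exact: nearW.
apply: ereal_nondecreasing_is_cvgn => i j ij.
by apply: ge0_le_integral_fun => // x _; exact: ndG.
Qed.

End MaximalFunction.

(** * Morrey bounds *)

(** Identities between products of real powers of positive numbers become linear
    identities between exponents once the numbers are written [expR u]. *)
Lemma gt0_expR (R : realType) (a : R) : 0 < a -> exists u, a = expR u.
Proof. by move=> a0; exists (ln a); rewrite lnK// posrE. Qed.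

Lemma powR_expR (R : realType) (u x : R) : expR u `^ x = expR (x * u).
Proof. by rewrite /powR gt_eqF ?expR_gt0// expRK. Qed.

Lemma holder_bound d (T : measurableType d) (R : realType)
    (nu : {measure set T -> \bar R}) (A : set T) (g : T -> \bar R) (p a b : R) :
  1 < p -> 0 < a -> 0 < b -> measurable A -> measurable_fun setT g ->
  (forall x, 0 <= g x)%E -> (nu A <= a%:E)%E ->
  (\int[nu]_(x in A) g x `^ p <= b%:E)%E ->
  (\int[nu]_(x in A) g x <= (2 * (a `^ (1 - p^-1) * b `^ p^-1))%:E)%E.
Proof.
move=> p1 a0 b0 mA mg g0 hA hb.
have p0 : 0 < p by exact: lt_trans p1.
(* At the level [L] both terms of the splitting contribute the same amount. *)
pose L := (b / a) `^ p^-1.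
have L0 : 0 < L by rewrite powR_gt0// divr_gt0.
have mgp : measurable_fun A (fun x => g x `^ p)%E.
  exact/measurable_funTS/(measurableT_comp (measurable_poweR p) mg).
apply: (@le_trans _ _ (\int[nu]_(x in A) (L%:E + (L `^ (1 - p))%:E * g x `^ p)))%E.
  apply: ge0_le_integral_fun => // x _.
  have := mule_powR_split p1 L0 ler01 (g0 x).
  by rewrite !powR1 !mule1.
rewrite ge0_integralD//; first last.
- exact: measurable_funeM.
- by move=> x _; apply: mule_ge0; rewrite ?lee_fin ?powR_ge0 ?poweR_ge0.
- by move=> x _; rewrite lee_fin ltW.
rewrite integral_cst// ge0_integralZl//; first last.
- by rewrite lee_fin powR_ge0.
- by move=> x _; rewrite poweR_ge0.
have -> : (2 * (a `^ (1 - p^-1) * b `^ p^-1))%:E =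
    (L%:E * a%:E + (L `^ (1 - p))%:E * b%:E)%E.
  have e1 : a `^ (1 - p^-1) * b `^ p^-1 = L * a.
    rewrite /L; have [u ->] := gt0_expR a0; have [v ->] := gt0_expR b0.
    by rewrite -expRN -expRD !powR_expR -!expRD; congr expR; field; rewrite gt_eqF.
  have e2 : a `^ (1 - p^-1) * b `^ p^-1 = L `^ (1 - p) * b.
    rewrite /L; have [u ->] := gt0_expR a0; have [v ->] := gt0_expR b0.
    by rewrite -expRN -expRD !powR_expR -!expRD; congr expR; field; rewrite gt_eqF.
  by rewrite -!EFinM -EFinD -e1 -e2 mulr_natl mulr2n.
by apply: leeD; apply: lee_wpmul2l; rewrite ?lee_fin ?powR_ge0 ?(ltW L0).
Qed.

Section MorreyBound.
Context (R : realType) (X : pmetricType R).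
Variable mu : {outer_measure set X -> \bar R}.
Hypothesis hM : metric_measure mu.
Local Notation nu := (cara_measure mu).
Local Notation m := (ball_mass mu).
Local Notation T := (caratheodory_type mu).

(** For [N > 0], the condition [morrey_norm mu p q f <= N] freed from roots. *)
Definition morrey_bound (p q N : R) (f : X -> \bar R) : Prop :=
  forall x r, 0 < r -> (\int[nu]_(y in ball x r) (`|f y| `^ p) <=
    (N `^ p * m x r `^ (1 - p / q))%:E)%E.

Lemma morrey_boundP p q N f : 0 < p -> 0 < N ->
  (morrey_norm mu p q f <= N%:E)%E <-> morrey_bound p q N f.
Proof.
move=> p0 N0.
have key x r : 0 < r -> (mu (ball x r) `^ (q^-1 - p^-1) *
    (\int[nu]_(y in ball x r) (`|f y| `^ p)) `^ p^-1 <= N%:E)%E <->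
    (\int[nu]_(y in ball x r) (`|f y| `^ p) <=
      (N `^ p * m x r `^ (1 - p / q))%:E)%E.
  move=> r0; rewrite ball_massE//.
  have m0 := ball_mass_gt0 hM x r0.
  set I := (\int[nu]_(y in ball x r) (`|f y| `^ p))%E.
  have I0 : (0 <= I)%E by apply: integral_ge0 => y _; exact: poweR_ge0.
  set M := m x r `^ (q^-1 - p^-1).
  have M0 : 0 < M by rewrite powR_gt0.
  have E : N `^ p * m x r `^ (1 - p / q) = (M^-1 * N) `^ p.
    rewrite powRM ?invr_ge0 ?(ltW M0) ?(ltW N0)// mulrC; congr (_ * _).
    rewrite -powRN -powRrM; congr (_ `^ _).
    have [->|q0] := eqVneq q 0; last by field; rewrite q0 gt_eqF.
    by rewrite invr0; field; rewrite gt_eqF.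
  have MN0 : 0 <= M^-1 * N by rewrite mulr_ge0 ?invr_ge0 ?(ltW M0) ?(ltW N0).
  rewrite E poweR_EFin -lee_pdivlMl// -EFinM.
  have p10 : 0 <= p^-1 by rewrite invr_ge0 ltW.
  split=> h.
    have := ge0_le_poweR (ltW p0) (poweR_ge0 _ _) h.
    by rewrite -poweRrM mulVf ?gt_eqF// poweRe1.
  have := ge0_le_poweR p10 I0 h.
  by rewrite poweR_EFin -powRrM mulfV ?gt_eqF// powRr1.
split=> [h x r r0|h].
  apply/key => //; apply: le_trans h; apply: ereal_sup_ubound.
  by exists (x, r).
by apply: ge_ereal_sup => _ [[x r] /= r0 <-]; apply/key => //; exact: h.
Qed.

(** With [s > 1] this lowers the exponents for a gradient [g] to those of [g ^ s];
    with [s^-1] it returns from the maximal function of [g ^ s]. *)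
Lemma morrey_bound_pow p q N s f : 0 < s -> 0 < N ->
  (forall x, 0 <= f x)%E ->
  morrey_bound p q N f ->
  morrey_bound (p / s) (q / s) (N `^ s) (fun x => f x `^ s)%E.
Proof.
move=> s0 N0 f0 h x r r0; have := h x r r0.
have -> : p / s / (q / s) = p / q.
  have [->|q0] := eqVneq q 0; last by field; rewrite q0 gt_eqF.
  by rewrite mul0r invr0 !mulr0.
rewrite -powRrM mulrCA mulfV ?gt_eqF// mulr1; apply: le_trans.
apply: ge0_le_integral_fun => [y _|y _]; first exact: poweR_ge0.
by rewrite !gee0_abs ?poweR_ge0// -poweRrM mulrCA mulfV ?gt_eqF// mulr1.
Qed.

Lemma morrey_boundZ p q N k f : 0 < p -> 0 <= N -> 0 <= k ->
  measurable_function mu f -> (forall x, 0 <= f x)%E ->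
  morrey_bound p q N f -> morrey_bound p q (k * N) (fun x => k%:E * f x)%E.
Proof.
move=> p0 N0 k0 mf f0 h x r r0.
under eq_integral do rewrite gee0_abs ?mule_ge0 ?lee_fin// poweRM ?lee_fin//.
rewrite ge0_integralZl//; first last.
- by rewrite lee_fin powR_ge0.
- by move=> y _; exact: poweR_ge0.
- exact/measurable_funTS/(measurableT_comp (measurable_poweR p) mf).
- exact: cara_ball.
rewrite powRM// -mulrA EFinM lee_wpmul2l ?lee_fin ?powR_ge0//.
apply: le_trans (h x r r0); apply: ge0_le_integral_fun => y _.
  exact: poweR_ge0.
by rewrite gee0_abs.
Qed.

Lemma morrey_average p q N f x r : 1 < p -> 0 < N -> 0 < q ->
  measurable_function mu f -> morrey_bound p q N f -> 0 < r ->
  ((m x r)^-1%:E * \int[nu]_(y in ball x r) `|f y| <=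
    (2 * N * m x r `^ (- q^-1))%:E)%E.
Proof.
move=> p1 N0 q0 mf h r0; have p0 : 0 < p by exact: lt_trans p1.
have m0 := ball_mass_gt0 hM x r0.
have mabs : measurable_fun [set: T] (fun x => `|f x|)%E.
  exact: (measurableT_comp (@abse_measurable _ _) mf).
rewrite lee_pdivrMl// -EFinM.
have b0 : 0 < N `^ p * m x r `^ (1 - p / q) by rewrite mulr_gt0 ?powR_gt0.
have hA : (nu (ball x r) <= (m x r)%:E)%E by rewrite cara_ball_massE.
apply: (le_trans (holder_bound p1 m0 b0 (cara_ball hM _ _) mabs
  (fun=> abse_ge0 _) hA (h x r r0))).
rewrite lee_fin; have [u ->] := gt0_expR N0; have [v ->] := gt0_expR m0.
rewrite !powR_expR -!expRD !powR_expR -!expRD mulrCA -mulrA -!expRD.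
rewrite le_eqVlt; apply/orP; left; apply/eqP.
by congr (_ * expR _); field; rewrite !gt_eqF.
Qed.

Variable C0 : R.
Hypothesis hC0 : 1 <= C0.
Hypothesis hD : doubling mu C0.

Definition morrey_maximal_const (p : R) : R :=
  ((maximal_const C0 p + 2 `^ p) * C0) `^ p^-1.

(** On a ball [B], radii smaller than that of [B] only see [f] on the doubled
    ball, where the strong type inequality applies; averages over larger balls
    are controlled by the Morrey condition at the scale of [B]. *)
Lemma morrey_maximal p q N f : 1 < p -> p <= q -> 0 < N ->
  measurable_function mu f -> morrey_bound p q N f ->
  morrey_bound p q (morrey_maximal_const p * N) (fractional_maximal mu 0 f).
Proof.
move=> p1 pq N0 mf h z rho rho0.
have p0 : 0 < p by exact: lt_trans p1.
have q0 : 0 < q by exact: lt_le_trans pq.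
have C00 : 0 < C0 by exact: lt_le_trans hC0.
have m0 := ball_mass_gt0 hM z rho0.
have rho20 : 0 < 2 * rho by rewrite mulr_gt0.
pose D : set T := ball z (2 * rho).
have mD : measurable D by exact: cara_ball.
pose f1 : X -> \bar R := f \_ D.
have mf1 : measurable_function mu f1 by exact: measurable_erestrict.
pose L := 2 * N * (m z rho / C0) `^ (- q^-1).
have L0 : 0 <= L by rewrite !mulr_ge0 ?powR_ge0 ?(ltW N0).
have mMp g : measurable_function mu g ->
    measurable_fun [set: T] (fun x => fractional_maximal mu 0 g x `^ p)%E.
  move=> mg; apply: (measurableT_comp (measurable_poweR p)).
  exact: measurable_fractional_maximal.
have split x : ball z rho x -> (fractional_maximal mu 0 f x `^ p <=
    fractional_maximal mu 0 f1 x `^ p + (L `^ p)%:E)%E.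
  move=> /ballP zx.
  have : (fractional_maximal mu 0 f x <=
      maxe (fractional_maximal mu 0 f1 x) L%:E)%E.
    apply: fractional_maximal_le => r r0; rewrite le_max.
    have [rrho|rhor] := ltP r rho; apply/orP; [left|right].
      apply: le_trans (@fractional_maximal_ge _ _ mu 0 f1 x r r0).
      rewrite (@eq_integral _ _ _ nu (ball x r) (fun y => `|f1 y|)%E)//.
      move=> y; rewrite inE => xy; rewrite /f1 /patch mem_set//.
      by apply: ball_sub xy; lra.
    rewrite powRr0 mul1r; apply: (le_trans (morrey_average x p1 N0 q0 mf h r0)).
    have mx0 := ball_mass_gt0 hM x r0.
    rewrite lee_fin /L ler_wpM2l ?mulr_ge0 ?(ltW N0)//.
    rewrite !powRN lef_pV2 ?posrE ?powR_gt0 ?divr_gt0//.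
    apply: ge0_ler_powR; rewrite ?nnegrE ?invr_ge0 ?divr_ge0 ?(ltW q0) ?(ltW m0)
      ?(ltW C00) ?(ltW mx0)//.
    rewrite ler_pdivrMr// mulrC -[C0]expr1.
    by apply: (ball_mass_cmp hM hC0 hD r0); rewrite metric_sym expr1; lra.
  move=> /(ge0_le_poweR (ltW p0) (fractional_maximal_ge0 hM _ _ _)).
  move=> /le_trans; apply.
  have [_|_] := leP (fractional_maximal mu 0 f1 x) L%:E.
    by rewrite leeDr// poweR_ge0.
  by rewrite leeDl// lee_fin powR_ge0.
have -> : (\int[nu]_(y in ball z rho) `|fractional_maximal mu 0 f y| `^ p =
    \int[nu]_(y in ball z rho) (fractional_maximal mu 0 f y `^ p))%E.
  by apply: eq_integral => y _; rewrite gee0_abs// fractional_maximal_ge0.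
apply: (le_trans (ge0_le_integral_fun nu _ split)).
  by move=> y _; exact: poweR_ge0.
rewrite ge0_integralD//; first last.
- by move=> y _; rewrite lee_fin powR_ge0.
- exact/measurable_funTS/mMp.
- by move=> y _; exact: poweR_ge0.
- exact: cara_ball.
rewrite integral_cst; last exact: cara_ball.
rewrite cara_ball_massE//.
set e := 1 - p / q.
have e0 : 0 <= e by rewrite subr_ge0 ler_pdivrMr// mul1r.
have e1 : e <= 1 by rewrite lerBlDr lerDl divr_ge0 ?ltW.
have part1 : (\int[nu]_(y in ball z rho) fractional_maximal mu 0 f1 y `^ p <=
    (maximal_const C0 p * C0 * (N `^ p * m z rho `^ e))%:E)%E.
  apply: (@le_trans _ _ (\int[nu]_y (fractional_maximal mu 0 f1 y `^ p)))%E.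
    by apply: ge0_le_integral_set => // y _; exact: poweR_ge0.
  apply: (le_trans (maximal_strong hM hC0 hD p1 mf1)).
  have -> : (\int[nu]_x `|f1 x| `^ p = \int[nu]_(x in D) `|f x| `^ p)%E.
    rewrite [RHS]integral_mkcond; apply: eq_integral => y _.
    rewrite /f1 /patch; case: ifP => // _.
    by rewrite abse0 poweR0r// gt_eqF.
  move: (maximal_const C0 p) (maximal_const_gt0 hC0 p1) => K K0.
  rewrite -(mulrA K) EFinM lee_wpmul2l ?lee_fin ?(ltW K0)//.
  apply: (le_trans (h z _ rho20)); rewrite lee_fin mulrCA ler_wpM2l ?powR_ge0//.
  apply: (@le_trans _ _ ((C0 * m z rho) `^ e)).
    apply: ge0_ler_powR; rewrite ?nnegrE ?mulr_ge0 ?ball_mass_ge0 ?(ltW C00)//.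
    have := ball_mass_double hM hC0 hD 1 z rho0.
    by rewrite !expr1.
  rewrite powRM ?ball_mass_ge0 ?(ltW C00)// ler_wpM2r ?powR_ge0//.
  by rewrite ler1_powR.
have part2 : ((L `^ p)%:E * (m z rho)%:E <=
    (2 `^ p * C0 * (N `^ p * m z rho `^ e))%:E)%E.
  rewrite -EFinM lee_fin /L !powRM ?powR_ge0 ?mulr_ge0 ?(ltW N0) ?invr_ge0
    ?(ltW C00) ?(ltW m0) ?powR_ge0//.
  rewrite -[C0^-1]powR_inv1 ?(ltW C00)// -!powRrM.
  have -> : m z rho `^ e = m z rho `^ (- q^-1 * p) * m z rho.
    rewrite -[X in _ = _ * X]powRr1 ?(ltW m0)// -powRD ?(gt_eqF m0) ?implybT//.
    by congr (_ `^ _); rewrite /e; field; rewrite gt_eqF.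
  have C1 : C0 `^ (-1 * (- q^-1 * p)) <= C0.
    rewrite ler1_powR// mulN1r mulNr opprK mulrC ler_pdivrMr// mul1r//.
  set u := m z rho `^ _; set v := C0 `^ _.
  have -> : 2 `^ p * N `^ p * (u * v) * m z rho =
    v * (2 `^ p * N `^ p * u * m z rho) by ring.
  have -> : 2 `^ p * C0 * (N `^ p * (u * m z rho)) =
    C0 * (2 `^ p * N `^ p * u * m z rho) by ring.
  by rewrite ler_wpM2r// !mulr_ge0 ?powR_ge0 ?(ltW m0).
apply: (le_trans (leeD part1 part2)); rewrite -EFinD lee_fin.
rewrite powRM ?powR_ge0 ?(ltW N0)// /morrey_maximal_const -powRrM mulVf ?gt_eqF//.
rewrite powRr1; last first.
  by rewrite mulr_ge0 ?addr_ge0 ?powR_ge0 ?(ltW C00)// ltW// maximal_const_gt0.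
by rewrite -!(mulrA _ C0) -mulrDl -!mulrA.
Qed.

Section Adams.
Variables (c Q alpha theta p q pstar qstar : R).
Hypotheses (hc : 0 < c) (hL : measure_lower_bound mu c Q) (Q0 : 0 < Q).
Hypotheses (p1 : 1 < p) (pq : p <= q) (thetaE : theta = alpha * q / Q).
Hypotheses (theta0 : 0 <= theta) (theta1 : theta < 1).
Hypotheses (pstarE : pstar = p / (1 - theta)) (qstarE : qstar = q / (1 - theta)).

Definition adams_const : R :=
  (2 * c `^ (- q^-1)) `^ theta * morrey_maximal_const p `^ (1 - theta).

(** The plain average has two bounds: the maximal function, and the Morrey decay
    [r `^ (- (Q / q))].  The exponents [1 - theta] and [theta] interpolate between
    them so that the powers of the radius cancel. *)
Lemma adams_pointwise N f x : 0 < N -> measurable_function mu f ->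
  morrey_bound p q N f ->
  (fractional_maximal mu alpha f x <=
    fractional_maximal mu 0 f x `^ (1 - theta) *
      ((2 * c `^ (- q^-1) * N) `^ theta)%:E)%E.
Proof.
move=> N0 mf h; have p0 : 0 < p by exact: lt_trans p1.
have q0 : 0 < q by exact: lt_le_trans pq.
apply: fractional_maximal_le => r r0.
have m0 := ball_mass_gt0 hM x r0.
have avg := morrey_average x p1 N0 q0 mf h r0.
have := @fractional_maximal_ge _ _ mu 0 f x r r0; rewrite powRr0 mul1r.
rewrite EFinM -muleA.
set A := (_ * \int[nu]_(y in _) _)%E in avg *.
have A0 : (0 <= A)%E.
  by apply: mule_ge0; [rewrite lee_fin invr_ge0 ltW|exact: integral_ge0].
have Afin : A \is a fin_num.
  by rewrite ge0_fin_numE//; apply: le_lt_trans avg _; rewrite ltry.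
move: A0 avg; rewrite -(fineK Afin); set a := fine A.
rewrite !lee_fin => a0 avg aM.
have P0 : 0 <= 2 * c `^ (- q^-1) * N by rewrite !mulr_ge0 ?powR_ge0 ?(ltW N0).
have aP : r `^ (Q / q) * a <= 2 * c `^ (- q^-1) * N.
  rewrite mulrC -ler_pdivlMr ?powR_gt0//; apply: (le_trans avg).
  have cm : c * r `^ Q <= m x r.
    by have := hL x r0; rewrite ball_massE// lee_fin.
  apply: (@le_trans _ _ (2 * N * (c * r `^ Q) `^ (- q^-1))).
    rewrite ler_wpM2l ?mulr_ge0 ?(ltW N0)// !powRN.
    rewrite lef_pV2 ?posrE ?powR_gt0 ?mulr_gt0 ?powR_gt0//.
    by apply: ge0_ler_powR; rewrite ?nnegrE ?mulr_ge0 ?powR_ge0 ?invr_ge0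
      ?(ltW hc) ?(ltW m0) ?(ltW q0).
  rewrite le_eqVlt; apply/orP; left; apply/eqP.
  have [u ->] := gt0_expR r0; have [v ->] := gt0_expR hc.
  have [w ->] := gt0_expR N0.
  rewrite !powR_expR -!expRD !powR_expR -!expRN -!mulrA -!expRD.
  by congr (_ * expR _); field; rewrite gt_eqF.
have aa : r `^ alpha * a <= a `^ (1 - theta) * (r `^ (Q / q) * a) `^ theta.
  have [->|an0] := eqVneq a 0.
    by rewrite !mulr0 mulr_ge0 ?powR_ge0.
  have {an0} a0' : 0 < a by rewrite lt_neqAle eq_sym an0.
  rewrite le_eqVlt; apply/orP; left; apply/eqP.
  have [u ->] := gt0_expR r0; have [v ->] := gt0_expR a0'.
  rewrite !powR_expR -!expRD !powR_expR -!expRD; congr expR.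
  by rewrite thetaE; field; rewrite !gt_eqF.
rewrite -EFinM; apply: (@le_trans _ _
    (a%:E `^ (1 - theta) * ((2 * c `^ (- q^-1) * N) `^ theta)%:E)%E).
  rewrite poweR_EFin -EFinM lee_fin; apply: (le_trans aa).
  rewrite ler_wpM2l ?powR_ge0//; apply: ge0_ler_powR => //.
  by rewrite nnegrE mulr_ge0 ?powR_ge0.
rewrite lee_wpmul2r ?lee_fin ?powR_ge0//; apply: ge0_le_poweR => //.
by rewrite subr_ge0 ltW.
Qed.

Lemma adams N f : 0 < N -> measurable_function mu f ->
  morrey_bound p q N f ->
  morrey_bound pstar qstar (adams_const * N) (fractional_maximal mu alpha f).
Proof.
move=> N0 mf h x r r0.
have p0 : 0 < p by exact: lt_trans p1.
have q0 : 0 < q by exact: lt_le_trans pq.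
have t0 : 0 < 1 - theta by rewrite subr_gt0.
have C00 : 0 < C0 by exact: lt_le_trans hC0.
have CM0 : 0 < morrey_maximal_const p.
  rewrite powR_gt0// mulr_gt0// addr_gt0 ?powR_gt0//.
  exact: maximal_const_gt0.
have ps0 : 0 < pstar by rewrite pstarE divr_gt0.
have m0 := ball_mass_gt0 hM x r0.
set P := 2 * c `^ (- q^-1) * N.
have P0 : 0 < P by rewrite !mulr_gt0 ?powR_gt0.
apply: (@le_trans _ _ (\int[nu]_(y in ball x r)
    ((P `^ (theta * pstar))%:E * fractional_maximal mu 0 f y `^ p)))%E.
  apply: ge0_le_integral_fun => y _; first exact: poweR_ge0.
  have Mf0 := fractional_maximal_ge0 hM 0 f y.
  rewrite gee0_abs ?fractional_maximal_ge0//.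
  apply: (le_trans (ge0_le_poweR (ltW ps0) (fractional_maximal_ge0 hM _ _ _)
    (adams_pointwise y N0 mf h))).
  rewrite poweRM ?lee_fin ?poweR_ge0 ?powR_ge0// -poweRrM muleC.
  rewrite poweR_EFin -powRrM (_ : (1 - theta) * pstar = p)//.
  by rewrite pstarE mulrC divfK// gt_eqF.
rewrite ge0_integralZl//; first last.
- by rewrite lee_fin powR_ge0.
- by move=> y _; exact: poweR_ge0.
- apply/measurable_funTS/(measurableT_comp (measurable_poweR p)).
  exact: measurable_fractional_maximal.
- exact: cara_ball.
have {}h := morrey_maximal p1 pq N0 mf h x r0.
have {}h : (\int[nu]_(y in ball x r) (fractional_maximal mu 0 f y `^ p) <=
    ((morrey_maximal_const p * N) `^ p * m x r `^ (1 - p / q))%:E)%E.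
  apply: le_trans h; apply: ge0_le_integral_fun => y _; first exact: poweR_ge0.
  by rewrite gee0_abs// fractional_maximal_ge0.
apply: (@le_trans _ _ ((P `^ (theta * pstar))%:E *
    ((morrey_maximal_const p * N) `^ p * m x r `^ (1 - p / q))%:E)%E).
  by rewrite lee_wpmul2l// lee_fin powR_ge0.
rewrite -EFinM lee_fin (_ : pstar / qstar = p / q); last first.
  by rewrite pstarE qstarE; field; rewrite !gt_eqF.
rewrite mulrA ler_wpM2r ?powR_ge0// /P /adams_const pstarE.
rewrite le_eqVlt; apply/orP; left; apply/eqP.
have cq0 : 0 < 2 * c `^ (- q^-1) by rewrite mulr_gt0 ?powR_gt0.
have [u ->] := gt0_expR cq0; have [v ->] := gt0_expR N0.
have [w ->] := gt0_expR CM0.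
rewrite -!expRD !powR_expR -!expRD !powR_expR; congr expR.
by field; rewrite gt_eqF.
Qed.

End Adams.
End MorreyBound.

(** * Oscillation over thin annuli *)

Section Trace.
Context (R : realType) (X : pmetricType R).
Variable mu : {outer_measure set X -> \bar R}.
Hypothesis hM : metric_measure mu.
Variables C0 C1 : R.
Hypotheses (hC0 : 1 <= C0) (hD : doubling mu C0).
Hypotheses (hC1 : 0 < C1) (hA : relative_1_annular_decay mu C1).
Local Notation nu := (cara_measure mu).
Local Notation m := (ball_mass mu).
Local Notation T := (caratheodory_type mu).

(** Locked to keep rewriting from seeing through the quotient. *)
Definition ball_mean (f : X -> \bar R) (z : X) (t : R) : R :=
  locked (fine (\int[nu]_(y in ball z t) f y)%E / m z t).

Let C00 : 0 < C0. Proof. exact: lt_le_trans hC0. Qed.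

Section MeanOscillation.
Variables (F : X -> R) (g : X -> \bar R).
Hypotheses (F0 : forall u, 0 <= F u) (g0 : forall u, (0 <= g u)%E).
Hypothesis mF : measurable_function mu (fun u => (F u)%:E).
Hypothesis mg : measurable_function mu g.
Hypothesis Ffin : forall z t, (\int[nu]_(y in ball z t) (F y)%:E < +oo)%E.
Hypothesis gfin : forall z t, (\int[nu]_(y in ball z t) g y < +oo)%E.
Hypothesis Fg : forall u v,
  (`|F u - F v|%:E <= (mdist u v)%:E * (g u + g v))%E.

Local Notation meanF := (ball_mean (fun u => (F u)%:E)).
Local Notation meang := (ball_mean g).

Lemma meanFE z t : 0 < t ->
  (\int[nu]_(y in ball z t) (F y)%:E = (meanF z t * m z t)%:E)%E.
Proof.
move=> t0; rewrite /ball_mean -lock divfK ?gt_eqF ?(ball_mass_gt0 hM)// fineK//.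
by rewrite ge0_fin_numE// integral_ge0// => y _; rewrite lee_fin.
Qed.

Lemma meangE z t : 0 < t ->
  (\int[nu]_(y in ball z t) g y = (meang z t * m z t)%:E)%E.
Proof.
move=> t0; rewrite /ball_mean -lock divfK ?gt_eqF ?(ball_mass_gt0 hM)// fineK//.
by rewrite ge0_fin_numE// integral_ge0.
Qed.

Lemma meanF_ge0 z t : 0 <= meanF z t.
Proof.
rewrite /ball_mean -lock divr_ge0 ?ball_mass_ge0// fine_ge0//.
rewrite integral_ge0// => y _.
by rewrite lee_fin.
Qed.

Lemma meang_ge0 z t : 0 <= meang z t.
Proof.
by rewrite /ball_mean -lock divr_ge0 ?ball_mass_ge0// fine_ge0// integral_ge0.
Qed.

Lemma integral_affine (A : set X) (b D : R) : mu.-cara.-measurable A ->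
  0 <= b -> 0 <= D -> (\int[nu]_(y in A) (b%:E + D%:E * g y) =
    b%:E * mu A + D%:E * \int[nu]_(y in A) g y)%E.
Proof.
move=> mA b0 D0; rewrite ge0_integralD//; first last.
- exact/measurable_funTS/measurable_funeM.
- by move=> y _; rewrite mule_ge0// lee_fin.
rewrite integral_cst// ge0_integralZl//; exact: measurable_funTS.
Qed.

Lemma mean_dev z t a b D : 0 < t -> 0 <= a -> 0 <= b -> 0 <= D ->
  (forall v, ball z t v -> (`|F v - a|%:E <= b%:E + D%:E * g v)%E) ->
  `|meanF z t - a| <= b + D * meang z t.
Proof.
move=> t0 a0 b0 D0 h.
have m0 := ball_mass_gt0 hM z t0.
have mB := cara_ball hM z t.
rewrite ler_norml; apply/andP; split.
- rewrite lerBrDl addrC -lerBrDl opprK -(ler_pM2r m0) -lee_fin.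
  have -> : ((meanF z t + (b + D * meang z t)) * m z t)%:E =
      (\int[nu]_(y in ball z t) (F y)%:E +
        (b%:E * mu (ball z t) + D%:E * \int[nu]_(y in ball z t) g y))%E.
    by rewrite meanFE// meangE// ball_massE// -!EFinM -!EFinD; congr EFin; ring.
  rewrite -(integral_affine mB b0 D0) -ge0_integralD//.
  + rewrite EFinM -(cara_ball_massE hM) -integral_cst//.
    apply: ge0_le_integral_fun => v zv; first by rewrite lee_fin.
    apply: (@le_trans _ _ ((F v)%:E + `|F v - a|%:E)%E).
      rewrite -EFinD lee_fin -lerBlDl -normrN opprB; exact: ler_norm.
    by apply: leeD => //; exact: h.
  + by move=> v _; rewrite lee_fin.
  + exact: measurable_funTS.
  + by move=> v _; apply: adde_ge0; rewrite ?lee_fin// mule_ge0// lee_fin.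
  + apply: emeasurable_funD => //; apply/measurable_funTS/measurable_funeM => //.
- rewrite lerBlDr -(ler_pM2r m0) -lee_fin -meanFE//.
  have -> : ((b + D * meang z t + a) * m z t)%:E =
      ((b + a)%:E * mu (ball z t) + D%:E * \int[nu]_(y in ball z t) g y)%E.
    by rewrite meangE// ball_massE// -!EFinM -!EFinD; congr EFin; ring.
  rewrite -(integral_affine mB (addr_ge0 b0 a0) D0).
  apply: ge0_le_integral_fun => v zv; first by rewrite lee_fin.
  rewrite EFinD addeAC.
  apply: (@le_trans _ _ (`|F v - a|%:E + a%:E)%E).
    by rewrite -EFinD lee_fin -lerBlDr; exact: ler_norm.
  by rewrite leeD2r//; exact: h.
Qed.

Lemma point_dev u z t D : 0 < t -> 0 < D ->
  (forall v, ball z t v -> mdist u v <= D) ->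
  (`|F u - meanF z t|%:E <= (D * meang z t)%:E + D%:E * g u)%E.
Proof.
move=> t0 D0 h; have := g0 u; case guE : (g u) => [gu||]//; last first.
  by move=> _; rewrite gt0_muley ?lte_fin// addey ?leey.
rewrite lee_fin => gu0; rewrite -EFinM -EFinD lee_fin distrC [leRHS]addrC.
apply: mean_dev; rewrite ?mulr_ge0 ?(ltW D0)// => v zv.
rewrite distrC; apply: (le_trans (Fg u v)); rewrite guE ge0_muleDr ?lee_fin//.
apply: leeD; first by rewrite -EFinM lee_fin ler_wpM2r// h.
by rewrite lee_wpmul2r// lee_fin h.
Qed.

Lemma mean_dist z t z' t' D : 0 < t -> 0 < t' -> 0 < D ->
  (forall u v, ball z t u -> ball z' t' v -> mdist u v <= D) ->
  `|meanF z t - meanF z' t'| <= D * (meang z t + meang z' t').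
Proof.
move=> t0 t'0 D0 h; rewrite mulrDr [leRHS]addrC.
apply: mean_dev; rewrite ?meanF_ge0 ?mulr_ge0 ?meang_ge0 ?(ltW D0)// => u zu.
by apply: point_dev => // v; exact: h.
Qed.

Lemma meang_le k z t z' t' : 0 < t -> mdist z' z + t <= t' ->
  mdist z z' + t' <= 2 ^+ k * t -> meang z t <= C0 ^+ k * meang z' t'.
Proof.
move=> t0 h1 h2.
have t'0 : 0 < t'.
  by apply: lt_le_trans h1; apply: lt_le_trans t0 _; rewrite lerDr mdist_ge0.
have m0 := ball_mass_gt0 hM z t0.
have m'0 := ball_mass_gt0 hM z' t'0.
rewrite -(ler_pM2r m0) -lee_fin -meangE//.
apply: (@le_trans _ _ (\int[nu]_(y in ball z' t') g y)%E).
  by apply: ge0_le_integral_set => //; exact: ball_sub.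
rewrite meangE// lee_fin mulrAC mulrC ler_wpM2r ?meang_ge0//.
exact: (ball_mass_cmp hM hC0 hD).
Qed.

Definition telescope_const : R := 3 * (C0 + 1) * C0.

(** The comparison starts at [F u] itself, with the Hajlasz inequality at [u], and
    every further step doubles the radius. *)
Lemma telescope u r J : 0 < r ->
  (`|F u - meanF u (2 ^+ J * r)|%:E <= (r%:E * g u) +
    (telescope_const * \sum_(j < J.+1)
      (2 ^+ j * r * meang u (2 * (2 ^+ j * r))))%:E)%E.
Proof.
move=> r0.
have step t : 0 < t -> meang u t <= C0 * meang u (2 * t).
  move=> t0; have := @meang_le 1 u t u (2 * t) t0; rewrite !expr1 mdistxx !add0r.
  by apply; rewrite // ler_peMl ?(ltW t0)// ler1n.
have KC : C0 <= telescope_const.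
  by rewrite /telescope_const ler_peMl ?(ltW C00)//; have := hC0; lra.
have K0 : 0 <= telescope_const by apply: le_trans KC; exact: ltW.
elim: J => [|J ih].
  rewrite big_ord_recl big_ord0 expr0 mul1r addr0.
  apply: (le_trans (@point_dev u u r r r0 r0 _)).
    by move=> v /ballP /ltW.
  rewrite addeC leeD2l// lee_fin mulrCA ler_wpM2l ?(ltW r0)//.
  by apply: (le_trans (step _ r0)); rewrite ler_wpM2r// meang_ge0.
set t := 2 ^+ J * r in ih.
have t0 : 0 < t by rewrite mulr_gt0// exprn_gt0.
have tE : 2 ^+ J.+1 * r = 2 * t by rewrite exprS mulrA.
rewrite big_ord_recr /= tE mulrDr EFinD addeA.
apply: (@le_trans _ _ (`|F u - meanF u t|%:E +
    `|meanF u t - meanF u (2 * t)|%:E)%E).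
  by rewrite -EFinD lee_fin; exact: ler_distD.
apply: leeD => //; rewrite lee_fin.
have t20 : 0 < 2 * t by rewrite mulr_gt0.
have t30 : 0 < 3 * t by rewrite mulr_gt0.
apply: (le_trans (mean_dist t0 t20 t30 _)).
  move=> v w /ballP uv /ballP uw; rewrite metric_sym in uv.
  by have := metric_triangle v u w; lra.
have s1 := step _ t0; have s2 := step _ t20.
have gg := meang_ge0 u (2 * t).
have gg4 := meang_ge0 u (2 * (2 * t)).
apply: (@le_trans _ _ (3 * t * ((C0 + 1) * (C0 * meang u (2 * (2 * t)))))).
  rewrite ler_wpM2l ?(ltW t30)//.
  apply: (@le_trans _ _ ((C0 + 1) * meang u (2 * t))).
    by rewrite (mulrDl C0 1) mul1r lerD2r.
  by rewrite ler_wpM2l// addr_ge0// ltW.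
rewrite /telescope_const.
have -> : 3 * (C0 + 1) * C0 * (2 * t * meang u (2 * (2 * t))) =
  2 * (3 * t * ((C0 + 1) * (C0 * meang u (2 * (2 * t))))) by ring.
rewrite ler_peMl ?ler1n// !mulr_ge0 ?(ltW t0) ?addr_ge0// ltW//.
Qed.

Section Annulus.
Variables (x : X) (rho r s H : R).
Hypotheses (rho0 : 0 < rho) (r0 : 0 < r) (s1 : 1 < s) (H0 : 0 < H).
Hypothesis gH : forall t, rho <= t ->
  (\int[nu]_(y in ball x t) g y `^ s <= (H `^ s * m x t)%:E)%E.

Local Notation annulus := (ball x (rho + 2 * r) `\` ball x rho).

Lemma gradient_integral_le t : rho <= t ->
  (\int[nu]_(y in ball x t) g y <= (2 * H * m x t)%:E)%E.
Proof.
move=> rt; have t0 : 0 < t by exact: lt_le_trans rt.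
have m0 := ball_mass_gt0 hM x t0.
have b0 : 0 < H `^ s * m x t by rewrite mulr_gt0// powR_gt0.
have hB : (nu (ball x t) <= (m x t)%:E)%E by rewrite cara_ball_massE.
apply: (le_trans (holder_bound s1 m0 b0 (cara_ball hM _ _) mg g0 hB (gH rt))).
rewrite lee_fin le_eqVlt; apply/orP; left; apply/eqP.
have [u ->] := gt0_expR H0; have [v ->] := gt0_expR m0.
rewrite !powR_expR -!expRD !powR_expR -!expRD -mulrA -expRD.
by congr (_ * expR _); field; rewrite gt_eqF// (lt_trans _ s1).
Qed.

Lemma meang_center : meang x rho <= 2 * H.
Proof.
have m0 := ball_mass_gt0 hM x rho0.
by rewrite -(ler_pM2r m0) -lee_fin -meangE//; exact: gradient_integral_le.
Qed.

Lemma annulus_mass (a b : R) : 0 < b -> b < a ->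
  (mu (ball x a `\` ball x (a - b)) <= (C1 * (b / a) * m x a)%:E)%E.
Proof.
move=> b0 ba; have a0 : 0 < a by exact: lt_trans ba.
have a3 : a < 3 * a by lra.
have := hA x b0 ba x a0 a3.
rewrite ball_massE// -EFinM; apply: le_trans.
by apply: le_outer_measure => y [h1 h2]; split.
Qed.

Lemma measurable_annulus a b : mu.-cara.-measurable (ball x a `\` ball x b).
Proof. by apply: measurableD; exact: cara_ball. Qed.

Definition scale_const : R :=
  4 * C1 * C0 ^+ 4 * (8 * C1) `^ (1 - s^-1).

(** The gain over the trivial bound is the factor [r / t] coming from the annular
    decay inside each ball of the net.  Hölder's inequality on the annulus of
    width comparable to [t] provides the summable power of [t / rho]. *)
Lemma scale_bound t : r <= t -> t <= rho / 8 ->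
  exists phi : X -> R, [/\ measurable_fun [set: T] phi, forall u, 0 <= phi u,
    forall u, annulus u -> meang u (2 * t) <= phi u &
    (\int[nu]_(u in annulus) (phi u)%:E <=
      (scale_const * (r / t) * (t / rho) `^ (1 - s^-1) * H * m x (2 * rho))%:E)%E].
Proof.
move=> rt trho; have t0 : 0 < t by exact: lt_le_trans rt.
have s0 : 0 < s by exact: lt_trans s1.
have Asub : annulus `<=` ball x (rho + 2 * r) by move=> u [].
have [N [sepN NA coverN]] := finite_net hM hC0 hD Asub t0.
pose G z := fine (\int[nu]_(y in ball z (3 * t)) g y)%E.
have GE z : (G z)%:E = (\int[nu]_(y in ball z (3 * t)) g y)%E.
  by rewrite /G fineK// ge0_fin_numE// integral_ge0.
have G0 z : 0 <= G z by rewrite fine_ge0// integral_ge0.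
pose phi u := \sum_(z <- N) \1_(ball z t) u * (G z / m z t).
have mt0 z := ball_mass_gt0 hM z t0.
have term0 z u : 0 <= \1_(ball z t) u * (G z / m z t).
  by rewrite mulr_ge0 ?divr_ge0 ?(ltW (mt0 z)).
have mind z : measurable_fun [set: T] (fun u => \1_(ball z t) u : R).
  by apply: measurable_indic; exact: cara_ball.
exists phi; split.
- apply: measurable_sum => z; apply: measurable_funM => //.
- by move=> u; rewrite sumr_ge0.
- move=> u Au; have [z zN /= zu] := coverN u Au.
  rewrite /phi (big_rem z)//= indicE mem_set; last exact/ballP.
  rewrite mul1r; apply: ler_wpDr; first by rewrite sumr_ge0.
  have t20 : 0 < 2 * t by rewrite mulr_gt0.
  have h1 : fine (\int[nu]_(y in ball u (2 * t)) g y)%E <= G z.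
    rewrite -lee_fin GE fineK; last by rewrite ge0_fin_numE// integral_ge0.
    by apply: ge0_le_integral_set => //; apply: ball_sub; lra.
  have h2 : m z t <= m u (2 * t).
    by apply: ball_mass_le => //; rewrite metric_sym; lra.
  rewrite /ball_mean -lock.
  apply: ler_pM => //; rewrite ?fine_ge0 ?integral_ge0// ?invr_ge0 ?ball_mass_ge0//.
  by rewrite lef_pV2 ?posrE// (ball_mass_gt0 hM).
have mA := measurable_annulus (rho + 2 * r) rho.
pose U := ball x (rho + 2 * r + 3 * t) `\` ball x (rho - 3 * t).
have mU : mu.-cara.-measurable U := measurable_annulus _ _.
have step1 : (\int[nu]_(u in annulus) (phi u)%:E <=
    \sum_(z <- N) ((C1 * (2 * r / t))%:E * (G z)%:E))%E.
  under eq_integral do rewrite /phi -sumEFin.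
  rewrite ge0_integral_sum//; last 2 first.
  + move=> z; apply/measurable_EFinP/measurable_funTS.
    exact: measurable_funM.
  + by move=> z u _; rewrite lee_fin.
  apply: lee_sum => z _.
  under eq_integral do rewrite mulrC EFinM.
  rewrite ge0_integralZl//; last 2 first.
  + by apply/measurable_EFinP/measurable_funTS.
  + by rewrite lee_fin divr_ge0 ?(ltW (mt0 z)).
  rewrite integral_indic//; last exact: cara_ball.
  have w0 : 0 < 2 * r by rewrite mulr_gt0.
  have wR : 2 * r < rho + 2 * r by lra.
  have t3R : t < 3 * (rho + 2 * r) by lra.
  have := hA x w0 wR z t0 t3R; rewrite addrK ball_massE// -EFinM => h.
  apply: (@le_trans _ _ ((G z / m z t)%:E * (C1 * (2 * r / t) * m z t)%:E)%E).
    by rewrite lee_wpmul2l// lee_fin divr_ge0 ?(ltW (mt0 z)).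
  rewrite -!EFinM lee_fin; set K := C1 * (2 * r / t).
  have -> : G z / m z t * (K * m z t) = K * G z; last by [].
  by field; rewrite gt_eqF.
apply: (le_trans step1).
rewrite -ge0_sume_distrr; last by move=> z _; rewrite lee_fin.
have step2 : (\sum_(z <- N) (G z)%:E <= (C0 ^+ 4)%:E * \int[nu]_(y in U) g y)%E.
  under eq_bigr do rewrite GE.
  apply: (@sum_integral_overlap _ _ _ nu _ N (fun z => ball z (3 * t)) U g) => //.
  + by move=> z; exact: cara_ball.
  + by rewrite exprn_ge0// ltW.
  + move=> z /NA [/ballP xz nxz] y /ballP zy; split.
      by apply/ballP; have := metric_triangle x z y; lra.
    move=> /ballP xy; apply: nxz; apply/ballP.
    by rewrite metric_sym in zy; have := metric_triangle x y z; lra.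
  + move=> v _.
    have -> : \sum_(z <- N) \1_(ball z (3 * t)) v =
        (size [seq z <- N | mdist v z < 3 * t])%:R :> R.
      rewrite size_filter -sum1_count natr_sum [RHS]big_mkcond.
      apply: eq_bigr => z _; rewrite indicE.
      have [zv|zv] := pselect (ball z (3 * t) v).
        by rewrite mem_set//; move/ballP: zv; rewrite metric_sym => ->.
      rewrite memNset//; case: ifP => // h; exfalso; apply: zv.
      by apply/ballP; rewrite metric_sym.
    apply: (@size_separated _ _ _ hM _ hC0 hD 4 v t (3 * t)) => //.
    * by rewrite mulr_ge0// ltW.
    * exact: pairwise_filter.
    * by move=> z; rewrite mem_filter => /andP[].
    * by rewrite (_ : 2 ^+ 4 = 16 :> R); [lra|rewrite -natrX].
have M0 : 0 < m x (2 * rho) by rewrite (ball_mass_gt0 hM)// mulr_gt0.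
set M := m x (2 * rho) in M0 *.
have step3 : (\int[nu]_(y in U) g y <=
    (2 * ((8 * C1) `^ (1 - s^-1) * (t / rho) `^ (1 - s^-1) * H * M))%:E)%E.
  have a0 : 0 < 8 * C1 * (t / rho) * M by rewrite !mulr_gt0 ?invr_gt0.
  have b0 : 0 < H `^ s * M by rewrite mulr_gt0// powR_gt0.
  have Ua : (nu U <= (8 * C1 * (t / rho) * M)%:E)%E.
    have h0 : 0 < 2 * r + 6 * t by rewrite addr_gt0 ?mulr_gt0.
    have hR : 2 * r + 6 * t < rho + 2 * r + 3 * t by lra.
    have := annulus_mass h0 hR.
    rewrite (_ : rho + 2 * r + 3 * t - (2 * r + 6 * t) = rho - 3 * t); last by ring.
    move=> /le_trans; apply; rewrite lee_fin.
    apply: ler_pM; rewrite ?ball_mass_ge0 ?mulr_ge0 ?invr_ge0 ?(ltW hC1) ?(ltW h0)//.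
    + by lra.
    + rewrite (mulrC 8) -mulrA ler_wpM2l ?(ltW hC1)// mulrA.
      apply: ler_pM; rewrite ?invr_ge0 ?(ltW h0)//; [lra|lra|].
      by rewrite lef_pV2 ?posrE//; have := r0; lra.
    + by apply: ball_mass_le => //; rewrite mdistxx; lra.
  have Ub : (\int[nu]_(y in U) g y `^ s <= (H `^ s * M)%:E)%E.
    have h2 : rho <= 2 * rho by lra.
    apply: le_trans (gH h2); apply: ge0_le_integral_set.
      move=> y [/ballP xy _]; apply/ballP; lra.
    by move=> y _; exact: poweR_ge0.
  apply: (le_trans (holder_bound s1 a0 b0 mU mg g0 Ua Ub)).
  rewrite lee_fin le_eqVlt; apply/orP; left; apply/eqP; congr (_ * _).
  have c80 : 0 < 8 * C1 by rewrite mulr_gt0.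
  have [u ->] := gt0_expR H0; have [v ->] := gt0_expR M0.
  have [w ->] := gt0_expR c80.
  have tr0 : 0 < t / rho by rewrite divr_gt0.
  have [k ->] := gt0_expR tr0.
  rewrite !powR_expR -!expRD !powR_expR -!expRD; congr expR.
  by field; rewrite gt_eqF.
have CC0 : 0 <= C1 * (2 * r / t).
  by rewrite !mulr_ge0 ?invr_ge0 ?(ltW hC1) ?(ltW r0) ?(ltW t0).
have C40 : 0 <= C0 ^+ 4 by rewrite exprn_ge0// ltW.
apply: (le_trans (lee_wpmul2l _ (le_trans step2 (lee_wpmul2l _ step3)))).
- by rewrite lee_fin.
- by rewrite lee_fin.
rewrite -!EFinM lee_fin /scale_const le_eqVlt; apply/orP; left; apply/eqP.
set A1 := (8 * C1) `^ _; set A2 := (t / rho) `^ _.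
by field; rewrite gt_eqF.
Qed.

Lemma trace_large : rho <= 8 * r ->
  (\int[nu]_(u in annulus) `|F u - meanF x rho|%:E <=
    (80 * (r * H * m x (rho + 2 * r)))%:E)%E.
Proof.
move=> rho8; set rr := rho + 2 * r.
have rr10 : rr <= 10 * r by rewrite /rr; lra.
have rhorr : rho <= rr by rewrite /rr lerDl mulr_ge0// ltW.
have rr0 : 0 < rr by exact: lt_le_trans rhorr.
have D0 : 0 < 2 * rr by rewrite mulr_gt0.
have b0 : 0 <= 2 * rr * meang x rho by rewrite mulr_ge0 ?meang_ge0// ltW.
have mB : mu.-cara.-measurable (ball x rr) by exact: cara_ball.
apply: (@le_trans _ _ (\int[nu]_(u in ball x rr)
    ((2 * rr * meang x rho)%:E + (2 * rr)%:E * g u))%E).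
  apply: ge0_le_integral_sub.
  - by move=> u [].
  - by move=> u _; rewrite adde_ge0 ?lee_fin// mule_ge0// lee_fin ltW.
  - by move=> u _; rewrite lee_fin.
  - move=> u [/ballP xu _]; apply: point_dev => // v /ballP xv.
    rewrite metric_sym in xu; apply: le_trans (metric_triangle u x v) _.
    by rewrite mulr_natl mulr2n lerD ?ltW// (lt_le_trans xv).
rewrite integral_affine ?(ltW D0)// ball_massE//.
apply: (@le_trans _ _ ((2 * rr * meang x rho)%:E * (m x rr)%:E +
    (2 * rr)%:E * (2 * H * m x rr)%:E)%E).
  by apply: leeD => //; rewrite lee_wpmul2l ?lee_fin ?(ltW D0)// gradient_integral_le.
rewrite -!EFinM -EFinD lee_fin.
have m0 := ball_mass_gt0 hM x rr0.
apply: (@le_trans _ _ (8 * (rr * (H * m x rr)))).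
  have h1 : 2 * rr * meang x rho * m x rr <= 2 * rr * (2 * H) * m x rr.
    by rewrite ler_wpM2r ?(ltW m0)// ler_wpM2l ?(ltW D0)// meang_center.
  apply: (le_trans (lerD h1 (lexx _))).
  by rewrite le_eqVlt; apply/orP; left; apply/eqP; ring.
have Hm : 0 <= H * m x rr by rewrite mulr_ge0 ?(ltW H0) ?(ltW m0).
have := ler_wpM2r Hm rr10.
by rewrite -(mulrA r); set q := H * m x rr; rewrite -(mulrA 10) => h; lra.
Qed.

Definition scale_sum_const : R :=
  2 `^ (1 - s^-1) / (2 `^ (1 - s^-1) - 1).

Let sigma_gt0 : 0 < 1 - s^-1.
Proof. by rewrite subr_gt0 invf_lt1// (lt_trans _ s1). Qed.

Let two_sigma : 1 < 2 `^ (1 - s^-1).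
Proof.
rewrite -[X in X < _](powRr0 2) /powR gt_eqF// mul0r ltr_expR mulr_gt0//.
by rewrite ln_gt0// ltr1n.
Qed.

(** Successive terms grow by the factor [2 ^ (1 - 1 / s) > 1], so that the last
    one dominates. *)
Lemma scale_sum J : \sum_(j < J.+1) (2 ^+ j * r / rho) `^ (1 - s^-1) <=
  scale_sum_const * (2 ^+ J * r / rho) `^ (1 - s^-1).
Proof.
have := two_sigma; set q := 2 `^ (1 - s^-1) => tq.
have q1 : 0 < q - 1 by rewrite subr_gt0.
rewrite /scale_sum_const -/q.
elim: J => [|J ih].
  rewrite big_ord_recl big_ord0 addr0 ler_peMl ?powR_ge0//.
  by rewrite ler_pdivlMr// mul1r gerBl.
rewrite big_ord_recr /=; apply: (le_trans (lerD ih (lexx _))).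
have -> : 2 ^+ J.+1 * r / rho = 2 * (2 ^+ J * r / rho) by rewrite exprS !mulrA.
have w0 : 0 <= 2 ^+ J * r / rho.
  by rewrite !mulr_ge0 ?exprn_ge0 ?invr_ge0 ?(ltW r0) ?(ltW rho0).
move: (2 ^+ J * r / rho) w0 => w w0; rewrite (powRM _ (ler0n R 2) w0) -/q.
by rewrite le_eqVlt; apply/orP; left; apply/eqP; field; rewrite gt_eqF.
Qed.

Lemma dyadic_scale : 8 * r <= rho ->
  exists J, 2 ^+ J * r <= rho / 8 < 2 ^+ J.+1 * r.
Proof.
move=> r8; pose P k := rho / 8 < 2 ^+ k * r.
have exP : exists k, P k.
  have [k hk] := exp2_ge ((rho / 8 + r) / r); exists k; rewrite /P.
  rewrite ler_pdivrMr// in hk; apply: lt_le_trans hk.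
  by rewrite ltrDl.
case: (ex_minnP exP) => -[|k] Pk kmin.
  by move: Pk; rewrite /P expr0 mul1r => h; exfalso; lra.
exists k; rewrite [_ < _]Pk andbT leNgt; apply/negP => /kmin.
by rewrite ltnn.
Qed.

Definition trace_small_const : R :=
  C0 * (2 + telescope_const * scale_const * scale_sum_const +
    16 * (C0 ^+ 6 + 1) * C1).

(** The telescope stops at a radius comparable to [rho].  The remaining comparison
    with the mean over [ball x rho] costs a multiple of [rho * H] at every point,
    and the mass of the annulus is at most a multiple of [r / rho]. *)
Lemma trace_small : 8 * r <= rho ->
  (\int[nu]_(u in annulus) `|F u - meanF x rho|%:E <=
    (trace_small_const * (r * H * m x (rho + 2 * r)))%:E)%E.
Proof.
move=> r8; have [J /andP[tJ1 tJ2]] := dyadic_scale r8.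
pose t j := 2 ^+ j * r.
have t0 j : 0 < t j by rewrite mulr_gt0// exprn_gt0.
have rt j : r <= t j by rewrite ler_peMl ?(ltW r0)// exprn_ege1// ler1n.
have tJ j : (j <= J)%N -> t j <= rho / 8.
  move=> jJ; apply: le_trans tJ1.
  by rewrite ler_wpM2r ?(ltW r0)// ler_eXn2l// ltr1n.
set M := m x (2 * rho).
have rho20 : 0 < 2 * rho by rewrite mulr_gt0.
have M0 : 0 < M := ball_mass_gt0 hM x rho20.
have phi_ex j : exists f : X -> R, (j <= J)%N ->
    [/\ measurable_fun [set: T] f, forall u, 0 <= f u,
    forall u, annulus u -> meang u (2 * t j) <= f u &
    (\int[nu]_(u in annulus) (f u)%:E <= (scale_const * (r / t j) *
      (t j / rho) `^ (1 - s^-1) * H * M)%:E)%E].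
  case: (leqP j J) => jJ; last by exists (fun=> 0).
  by have [f hf] := scale_bound (rt j) (tJ _ jJ); exists f.
have [phi hphi] := choice phi_ex.
have K10 : 0 <= telescope_const.
  by rewrite /telescope_const !mulr_ge0 ?addr_ge0 ?(ltW C00).
have K20 : 0 <= scale_const.
  by rewrite /scale_const !mulr_ge0 ?exprn_ge0 ?powR_ge0 ?(ltW C00) ?(ltW hC1).
pose Psi u := telescope_const * \sum_(j < J.+1) t j * phi j u.
have phiP (j : 'I_J.+1) : (j <= J)%N by rewrite -ltnS.
have phi0 (j : 'I_J.+1) u : 0 <= phi j u by have [] := hphi j (phiP j).
have mphi (j : 'I_J.+1) : measurable_fun [set: T] (phi j).
  by have [] := hphi j (phiP j).
pose E := 8 * (C0 ^+ 6 + 1) * rho * H.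
have E0 : 0 <= E.
  by rewrite !mulr_ge0 ?addr_ge0 ?exprn_ge0 ?(ltW C00) ?(ltW rho0) ?(ltW H0).
have mPsi : measurable_fun [set: T] Psi.
  apply: measurable_funM => //; apply: measurable_sum => j.
  exact: measurable_funM.
have Psi0 u : 0 <= Psi u.
  by rewrite mulr_ge0// sumr_ge0// => j _; rewrite mulr_ge0// ltW.
have pointwise u : annulus u -> (`|F u - meanF x rho|%:E <=
    r%:E * g u + (Psi u)%:E + E%:E)%E.
  move=> Au; have [/ballP xu _] := Au.
  apply: (@le_trans _ _ (`|F u - meanF u (t J)|%:E +
      `|meanF u (t J) - meanF x rho|%:E)%E).
    by rewrite -EFinD lee_fin; exact: ler_distD.
  apply: leeD.
    apply: (le_trans (telescope u J r0)); rewrite leeD2l// lee_fin.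
    rewrite ler_wpM2l//; apply: ler_sum => j _; rewrite ler_wpM2l ?(ltW (t0 j))//.
    by have [_ _ + _] := hphi j (phiP j); apply.
  rewrite lee_fin; have rho40 : 0 < 4 * rho by rewrite mulr_gt0.
  have tJ8 := tJ _ (leqnn J).
  apply: (le_trans (mean_dist (t0 J) rho0 rho40 _)).
    move=> v w /ballP uv /ballP xw.
    have := metric_triangle v u w; have := metric_triangle u x w.
    by rewrite (metric_sym v u) (metric_sym u x); lra.
  have h6 : 2 ^+ 6 = 64 :> R by rewrite -natrX.
  have tJ16 : rho / 16 < t J by move: tJ2; rewrite exprS -mulrA -/(t J); lra.
  have h1 : meang u (t J) <= C0 ^+ 6 * meang x (2 * rho).
    apply: meang_le => //; first lra.
    by rewrite metric_sym h6; lra.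
  have h2 : meang x (2 * rho) <= 2 * H.
    by rewrite -(ler_pM2r M0) -lee_fin -meangE// gradient_integral_le//; lra.
  have h3 := meang_center.
  have -> : E = 4 * rho * (C0 ^+ 6 * (2 * H) + 2 * H) by rewrite /E; ring.
  rewrite ler_wpM2l ?(ltW rho40)// lerD// (le_trans h1)//.
  by rewrite ler_wpM2l// exprn_ge0// ltW.
have mA := measurable_annulus (rho + 2 * r) rho.
apply: (le_trans (ge0_le_integral_fun nu _ pointwise)).
  by move=> u _; rewrite lee_fin.
rewrite ge0_integralD//; first last.
- apply/measurable_funTS/emeasurable_funD; first exact: measurable_funeM.
  exact/measurable_EFinP.
- by move=> u _; rewrite adde_ge0 ?lee_fin// mule_ge0// lee_fin ltW.
rewrite ge0_integralD//; first last.
- exact/measurable_funTS/measurable_EFinP.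
- by move=> u _; rewrite lee_fin.
- exact/measurable_funTS/measurable_funeM.
- by move=> u _; rewrite mule_ge0// lee_fin ltW.
rewrite ge0_integralZl//; first last.
- by rewrite lee_fin ltW.
- exact: measurable_funTS.
rewrite integral_cst//.
have i1 : (r%:E * \int[nu]_(u in annulus) g u <= (2 * (r * H * M))%:E)%E.
  apply: (@le_trans _ _ (r%:E * (2 * H * M)%:E)%E).
    rewrite lee_wpmul2l ?lee_fin ?(ltW r0)//.
    have h2 : rho <= 2 * rho by lra.
    apply: le_trans (gradient_integral_le h2); apply: ge0_le_integral_set => //.
    by move=> u [/ballP xu _]; apply/ballP; lra.
  rewrite -EFinM lee_fin le_eqVlt; apply/orP; left; apply/eqP; ring.
have i2 : (\int[nu]_(u in annulus) (Psi u)%:E <=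
    (telescope_const * scale_const * scale_sum_const * (r * H * M))%:E)%E.
  under eq_integral do rewrite /Psi EFinM -sumEFin.
  rewrite ge0_integralZl//; first last.
  - by move=> u _; apply: sume_ge0 => j _; rewrite lee_fin mulr_ge0// ltW.
  - apply: emeasurable_sum => j; apply/measurable_EFinP/measurable_funTS.
    exact: measurable_funM.
  rewrite ge0_integral_sum//; first last.
  - by move=> j u _; rewrite lee_fin mulr_ge0// ltW.
  - by move=> j; apply/measurable_EFinP/measurable_funTS/measurable_funM.
  apply: (@le_trans _ _ (telescope_const%:E * \sum_(j < J.+1)
      (scale_const * r * H * M * (t j / rho) `^ (1 - s^-1))%:E)%E).
    rewrite lee_wpmul2l ?lee_fin//; apply: lee_sum => j _.
    under eq_integral do rewrite EFinM.
    rewrite ge0_integralZl//; first last.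
    - by rewrite lee_fin ltW.
    - by move=> u _; rewrite lee_fin.
    - exact/measurable_EFinP/measurable_funTS.
    have [_ _ _ h] := hphi j (phiP j).
    apply: (le_trans (lee_wpmul2l _ h)); first by rewrite lee_fin ltW.
    rewrite -EFinM lee_fin le_eqVlt; apply/orP; left; apply/eqP.
    have tj := t0 j; set w := (t j / rho) `^ _; set k := t j in tj *.
    by field; rewrite gt_eqF.
  rewrite sumEFin -mulr_sumr -EFinM lee_fin.
  have sumG : \sum_(j < J.+1) (t j / rho) `^ (1 - s^-1) <= scale_sum_const.
    apply: (le_trans (scale_sum J)).
    have S0 : 0 <= scale_sum_const.
      by rewrite divr_ge0 ?powR_ge0// subr_ge0 ltW.
    rewrite ler_piMr//.
    have tr : 2 ^+ J * r / rho <= 1 by rewrite ler_pdivrMr//; lra.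
    have n1 : 2 ^+ J * r / rho \in Num.nneg.
      by rewrite nnegrE !mulr_ge0 ?exprn_ge0 ?invr_ge0 ?(ltW r0) ?(ltW rho0).
    have n2 : (1 : R) \in Num.nneg by rewrite nnegrE.
    by have := ge0_ler_powR (ltW sigma_gt0) n1 n2 tr; rewrite powR1.
  have c0 : 0 <= telescope_const * (scale_const * r * H * M).
    apply: mulr_ge0 => //; apply: mulr_ge0; last exact: ltW.
    by apply: mulr_ge0; last exact: ltW; apply: mulr_ge0; last exact: ltW.
  rewrite mulrA; apply: (le_trans (ler_wpM2l c0 sumG)).
  by rewrite le_eqVlt; apply/orP; left; apply/eqP; ring.
have i3 : (E%:E * nu annulus <= (16 * (C0 ^+ 6 + 1) * C1 * (r * H * M))%:E)%E.
  apply: (@le_trans _ _ (E%:E * (C1 * (2 * r / rho) * M)%:E)%E).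
    rewrite lee_wpmul2l ?lee_fin//.
    have w0 : 0 < 2 * r by rewrite mulr_gt0.
    have wR : 2 * r < rho + 2 * r by lra.
    have := annulus_mass w0 wR; rewrite addrK => /le_trans; apply.
    rewrite lee_fin; apply: ler_pM; rewrite ?ball_mass_ge0//.
    - apply: mulr_ge0; first exact: ltW.
      by apply: divr_ge0; [exact: ltW|exact: ltW (lt_trans w0 wR)].
    - rewrite ler_wpM2l ?(ltW hC1)// ler_wpM2l ?(ltW w0)//.
      by rewrite lef_pV2 ?posrE ?addr_gt0// lerDl ltW.
    - by apply: ball_mass_le => //; rewrite mdistxx; lra.
  rewrite -EFinM lee_fin /E le_eqVlt; apply/orP; left; apply/eqP.
  by field; rewrite gt_eqF.
apply: (le_trans (leeD (leeD i1 i2) i3)); rewrite -!EFinD lee_fin -!mulrDl.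
rewrite /trace_small_const; set K := (2 + _ + _).
have K0 : 0 <= K.
  rewrite !addr_ge0 ?mulr_ge0 ?addr_ge0 ?exprn_ge0 ?invr_ge0 ?powR_ge0
    ?(ltW C00) ?(ltW hC1)//.
  by rewrite subr_ge0 ltW.
have rr0 : 0 < rho + 2 * r by rewrite addr_gt0// mulr_gt0.
have MM : M <= C0 * m x (rho + 2 * r).
  rewrite -[C0]expr1; apply: (ball_mass_cmp hM hC0 hD rr0).
  by rewrite mdistxx expr1; have := r0; lra.
apply: (@le_trans _ _ (K * (r * H * (C0 * m x (rho + 2 * r))))).
  by rewrite ler_wpM2l// ler_wpM2l// mulr_ge0// ltW.
by rewrite le_eqVlt; apply/orP; left; apply/eqP; ring.
Qed.

Lemma trace_small_const_ge0 : 0 <= trace_small_const.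
Proof.
rewrite /trace_small_const !mulr_ge0 ?addr_ge0 ?mulr_ge0 ?addr_ge0 ?exprn_ge0
  ?invr_ge0 ?powR_ge0 ?(ltW C00) ?(ltW hC1)//.
by rewrite subr_ge0 ltW.
Qed.

Definition trace_const : R := 80 + trace_small_const.

Lemma trace_const_gt0 : 0 < trace_const.
Proof. by rewrite /trace_const ltr_wpDr// trace_small_const_ge0. Qed.

(** A thin annulus is handled scale by scale in [trace_small].  When [r] is at
    least a fixed fraction of [rho], the diameter of the whole ball is at most a
    multiple of [r], and the Hajlasz inequality alone is enough. *)
Lemma annulus_oscillation : (\int[nu]_(u in annulus) `|F u - meanF x rho|%:E <=
    (trace_const * (r * H * m x (rho + 2 * r)))%:E)%E.
Proof.
have q0 : 0 <= r * H * m x (rho + 2 * r).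
  by rewrite !mulr_ge0 ?ball_mass_ge0// ltW.
have ts0 := trace_small_const_ge0.
have [h|/ltW h] := leP rho (8 * r).
  apply: (le_trans (trace_large h)); rewrite lee_fin ler_wpM2r//.
  by rewrite /trace_const lerDl.
apply: (le_trans (trace_small h)); rewrite lee_fin ler_wpM2r//.
by rewrite /trace_const lerDr.
Qed.

(** Since [F] is nonnegative and the ball around [y] contains the one around
    [x], the mean around [y] loses only what [F] may fall short of its mean over
    [ball x rho] on the annulus between them. *)
Lemma mean_shift y : mdist x y <= r ->
  meanF x rho <= meanF y (rho + r) + trace_const * C0 ^+ 2 * r * H.
Proof.
move=> xy; set c := meanF x rho; set By := ball y (rho + r).
have c0 : 0 <= c by exact: meanF_ge0.
have rr0 : 0 < rho + r by rewrite addr_gt0.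
have my0 := ball_mass_gt0 hM y rr0.
have mBy : mu.-cara.-measurable By by exact: cara_ball.
have mBx : mu.-cara.-measurable (ball x rho) by exact: cara_ball.
have mBD : mu.-cara.-measurable (By `\` ball x rho) by exact: measurableD.
have BxBy : ball x rho `<=` By.
  by apply: ball_sub; rewrite metric_sym addrC lerD2l.
have mFc : measurable_fun [set: T] (fun u => `|F u - c|%:E).
  apply/measurable_EFinP/measurableT_comp => //.
  by apply: measurable_funB => //; apply/measurable_EFinP.
have split (f : X -> \bar R) : measurable_function mu f ->
    (forall u, 0 <= f u)%E -> (\int[nu]_(u in By) f u =
    \int[nu]_(u in ball x rho) f u + \int[nu]_(u in By `\` ball x rho) f u)%E.
  move=> mf f0; rewrite -ge0_integral_setU//; first by rewrite setDUK.
  - exact: measurable_funTS.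
  - by apply/disj_setPS => u [h []].
have h1 : (\int[nu]_(u in By) c%:E <= \int[nu]_(u in By) (F u)%:E +
    \int[nu]_(u in annulus) `|F u - c|%:E)%E.
  rewrite (split (cst c%:E))//; last exact: measurable_cst.
  rewrite (split (fun u => (F u)%:E))//.
  rewrite -addeA; apply: leeD.
    by rewrite integral_cst// cara_ball_massE// meanFE// -EFinM.
  apply: (@le_trans _ _ (\int[nu]_(u in By `\` ball x rho)
      ((F u)%:E + `|F u - c|%:E))%E).
    apply: ge0_le_integral_fun => u _; first by rewrite lee_fin.
    by rewrite -EFinD lee_fin -lerBlDl -normrN opprB; exact: ler_norm.
  rewrite ge0_integralD//; first last.
  - exact: measurable_funTS.
  - exact: measurable_funTS.
  - by move=> u _; rewrite lee_fin.
  rewrite leeD2l//; apply: ge0_le_integral_set; last by move=> u _; rewrite lee_fin.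
  move=> u [/ballP yu nxu]; split => //; apply/ballP.
  by have := metric_triangle x y u; lra.
have h2 : (\int[nu]_(u in By) c%:E <= (meanF y (rho + r) * m y (rho + r))%:E +
    (trace_const * (r * H * m x (rho + 2 * r)))%:E)%E.
  by apply: (le_trans h1); rewrite -meanFE// leeD2l// annulus_oscillation.
move: h2; rewrite integral_cst// cara_ball_massE// -EFinM -EFinD lee_fin => h2.
move: trace_const (ltW trace_const_gt0) h2 => K K0 h2.
rewrite -(ler_pM2r my0); apply: (le_trans h2).
rewrite (mulrDl (meanF y (rho + r))) lerD2l.
have mm : m x (rho + 2 * r) <= C0 ^+ 2 * m y (rho + r).
  apply: (ball_mass_cmp hM hC0 hD rr0); rewrite metric_sym expr2; have := r0; have := rho0; lra.
have rH : 0 <= K * (r * H) by rewrite !mulr_ge0// ltW.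
rewrite mulrA; apply: (le_trans (ler_wpM2l rH mm)).
by rewrite le_eqVlt; apply/orP; left; apply/eqP; ring.
Qed.

End Annulus.
End MeanOscillation.
End Trace.

(** * A Hajlasz gradient of the fractional maximal function *)

Section FractionalGradient.
Context (R : realType) (X : pmetricType R).
Variable mu : {outer_measure set X -> \bar R}.
Hypothesis hM : metric_measure mu.
Variables C0 C1 : R.
Hypotheses (hC0 : 1 <= C0) (hD : doubling mu C0).
Hypotheses (hC1 : 0 < C1) (hA : relative_1_annular_decay mu C1).
Local Notation nu := (cara_measure mu).
Local Notation m := (ball_mass mu).
Local Notation T := (caratheodory_type mu).

Lemma null_cara (E : set X) : mu E = 0%E -> mu.-cara.-measurable E.
Proof.
move=> E0; apply: measure_is_complete_caratheodory.
have [B [mB EB muB]] := borel_regular hM E.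
exists B; split => //; first exact: (borel_measurable hM).
by rewrite -E0 -muB.
Qed.

Lemma eq_off_null_integral (E A : set X) (f g : X -> \bar R) :
  mu E = 0%E -> mu.-cara.-measurable A ->
  measurable_function mu f -> measurable_function mu g ->
  (forall x, 0 <= f x)%E -> (forall x, 0 <= g x)%E ->
  (forall x, ~ E x -> f x = g x) ->
  (\int[nu]_(x in A) f x = \int[nu]_(x in A) g x)%E.
Proof.
move=> E0 mA mf mg f0 g0 fg; apply: ge0_ae_eq_integral => //.
- exact: measurable_funTS.
- exact: measurable_funTS.
exists E; split => //; first exact: null_cara.
move=> x /= h; apply: contrapT => Ex; apply: h => _; exact: fg.
Qed.

Definition gradient_const (s : R) : R := trace_const C0 C1 s * C0 ^+ 2.

Lemma gradient_const_gt0 s : 1 < s -> 0 < gradient_const s.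
Proof.
move=> s1; rewrite mulr_gt0 ?trace_const_gt0// exprn_gt0//.
exact: lt_le_trans hC0.
Qed.

Section RealValued.
Variables (F : X -> R) (g : X -> \bar R) (alpha s : R).
Hypotheses (alpha0 : 0 <= alpha) (s1 : 1 < s).
Hypotheses (F0 : forall u, 0 <= F u) (g0 : forall u, (0 <= g u)%E).
Hypothesis mF : measurable_function mu (fun u => (F u)%:E).
Hypothesis mg : measurable_function mu g.
Hypothesis Ffin : forall z t, (\int[nu]_(y in ball z t) (F y)%:E < +oo)%E.
Hypothesis gfin : forall z t, (\int[nu]_(y in ball z t) g y < +oo)%E.
Hypothesis Fg : forall u v,
  (`|F u - F v|%:E <= (mdist u v)%:E * (g u + g v))%E.

Local Notation MF := (fractional_maximal mu alpha (fun u => (F u)%:E)).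
Local Notation Mg :=
  (fractional_maximal mu (alpha * s) (fun u => g u `^ s)%E).

Lemma fractional_shift x y h : 0 < h -> x != y -> (Mg x <= (h `^ s)%:E)%E ->
  (MF x <= MF y + (gradient_const s * mdist x y * h)%:E)%E.
Proof.
move=> h0 xy Mgh; have s0 : 0 < s by exact: lt_trans s1.
set r := mdist x y; have r0 : 0 < r by rewrite mdist_gt0.
apply: fractional_maximal_le => rho rho0.
have mx0 := ball_mass_gt0 hM x rho0.
have ra0 : 0 < rho `^ alpha by rewrite powR_gt0.
(* Larger radii carry larger weights in [Mg x], so [H] bounds the means of
   [g ^ s] over all balls around [x] of radius at least [rho]. *)
pose H := h / rho `^ alpha.
have H0 : 0 < H by rewrite divr_gt0.
have gH t : rho <= t ->
    (\int[nu]_(y in ball x t) g y `^ s <= (H `^ s * m x t)%:E)%E.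
  move=> rt; have t0 : 0 < t by exact: lt_le_trans rt.
  have mt0 := ball_mass_gt0 hM x t0.
  have := le_trans (fractional_maximal_ge (alpha * s) (fun u => g u `^ s)%E x t0) Mgh.
  under eq_integral do rewrite gee0_abs ?poweR_ge0//.
  have k0 : 0 < t `^ (alpha * s) / m x t by rewrite divr_gt0 ?powR_gt0.
  rewrite -lee_pdivlMl// => /le_trans; apply; rewrite -EFinM lee_fin.
  rewrite invf_div -mulrA mulrC ler_wpM2r ?(ltW mt0)// /H.
  have tr : (t `^ (alpha * s))^-1 <= (rho `^ (alpha * s))^-1.
    rewrite lef_pV2 ?posrE ?powR_gt0//; apply: ge0_ler_powR;
      by rewrite ?nnegrE ?mulr_ge0 ?(ltW s0) ?(ltW rho0) ?(ltW t0).
  have -> : (h / rho `^ alpha) `^ s = (rho `^ (alpha * s))^-1 * h `^ s.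
    have [u ->] := gt0_expR rho0; have [v ->] := gt0_expR h0.
    rewrite !powR_expR -!expRN -!expRD powR_expR; congr expR; ring.
  by rewrite ler_wpM2r ?powR_ge0.
have shift := mean_shift hM hC0 hD hC1 hA F0 g0 mF mg Ffin gfin Fg rho0 r0 s1 H0
  gH (lexx (mdist x y)).
have rr0 : 0 < rho + r by rewrite addr_gt0.
have my0 := ball_mass_gt0 hM y rr0.
have value z t : 0 < t ->
    ((t `^ alpha / m z t)%:E * \int[nu]_(u in ball z t) `|(F u)%:E| =
      (t `^ alpha * ball_mean mu (fun u => (F u)%:E) z t)%:E)%E.
  move=> t0; have mt0 := ball_mass_gt0 hM z t0.
  under eq_integral do rewrite gee0_abs ?lee_fin//.
  rewrite (meanFE hM F0 Ffin z t0) -EFinM; congr EFin.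
  by field; rewrite gt_eqF.
rewrite value//.
apply: (@le_trans _ _ (((rho + r) `^ alpha *
    ball_mean mu (fun u => (F u)%:E) y (rho + r))%:E +
    (gradient_const s * r * h)%:E)%E); last first.
  by apply: leeD => //; rewrite -value//; exact: fractional_maximal_ge.
rewrite -EFinD lee_fin; apply: (le_trans (ler_wpM2l (ltW ra0) shift)).
rewrite mulrDr; apply: lerD.
  apply: ler_wpM2r; first exact: meanF_ge0.
  by apply: ge0_ler_powR; rewrite ?nnegrE ?(ltW rho0) ?(ltW rr0) ?lerDl ?(ltW r0).
rewrite /gradient_const /H; move: (trace_const C0 C1 s) => K.
rewrite le_eqVlt; apply/orP; left; apply/eqP.
by field; rewrite gt_eqF.
Qed.

Lemma fractional_one_sided x y : x != y ->
  (MF x <= MF y + (mdist x y)%:E * ((gradient_const s)%:E * Mg x `^ s^-1))%E.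
Proof.
move=> xy; have s0 : 0 < s by exact: lt_trans s1.
have K0 := gradient_const_gt0 s1; set K := gradient_const s in K0 *.
have r0 : 0 < mdist x y by rewrite mdist_gt0.
have Mg0 := fractional_maximal_ge0 hM (alpha * s) (fun u => g u `^ s)%E x.
have MF0 := fractional_maximal_ge0 hM alpha (fun u => (F u)%:E) y.
case MgE : (Mg x) Mg0 => [a||]// a0; last first.
  rewrite poweRyr ?invr_eq0 ?gt_eqF// !gt0_muley ?lte_fin// addey ?leey//.
  by rewrite gt_eqF// (lt_le_trans _ MF0).
rewrite lee_fin in a0; rewrite poweR_EFin -!EFinM.
apply/lee_addgt0Pr => e e0.
(* [fractional_shift] requires a positive bound, whereas [a] may vanish. *)
pose h := a `^ s^-1 + e / (K * mdist x y).
have Kr0 : 0 < K * mdist x y by rewrite mulr_gt0.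
have er0 : 0 < e / (K * mdist x y) by rewrite divr_gt0.
have h0 : 0 < h by rewrite ltr_wpDl ?powR_ge0.
have := fractional_shift h0 xy; rewrite -/K MgE lee_fin => /(_ _).
have ah : a <= h `^ s.
  have -> : a = (a `^ s^-1) `^ s by rewrite -powRrM mulVf ?gt_eqF// powRr1.
  apply: ge0_ler_powR; rewrite ?nnegrE ?powR_ge0 ?(ltW s0) ?(ltW h0)//.
  by rewrite lerDl ltW.
move=> /(_ ah) /le_trans; apply; rewrite -addeA -EFinD leeD2l// lee_fin.
rewrite /h mulrDr le_eqVlt; apply/orP; left; apply/eqP.
rewrite (mulrC (K * mdist x y) (e / _)) divfK ?gt_eqF//; congr (_ + _); ring.
Qed.

End RealValued.

(** Redefining the gradient as [+oo] on the exceptional set makes the pointwise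
    inequality hold everywhere, without changing any integral. *)
Lemma fractional_hajlasz_gradient (f g : X -> \bar R) (alpha s : R) :
  0 <= alpha -> 1 < s -> measurable_function mu f -> measurable_function mu g ->
  hajlasz_gradient mu f g ->
  (forall z t, (\int[nu]_(y in ball z t) `|f y| < +oo)%E) ->
  (forall z t, (\int[nu]_(y in ball z t) g y < +oo)%E) ->
  mu [set x | fractional_maximal mu alpha f x = +oo%E] = 0%E ->
  hajlasz_gradient mu (fractional_maximal mu alpha f)
    (fun x => (gradient_const s)%:E *
      fractional_maximal mu (alpha * s) (fun u => g u `^ s) x `^ s^-1)%E.
Proof.
move=> alpha0 s1 mf mg [g0 [E E0 fg]] ffin gfin Minf.
have K0 := gradient_const_gt0 s1.
have h0 x : (0 <= (gradient_const s)%:E *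
    fractional_maximal mu (alpha * s) (fun u => g u `^ s) x `^ s^-1)%E.
  by rewrite mule_ge0 ?poweR_ge0// lee_fin ltW.
split => //.
have ffinE u : ~ E u -> f u \is a fin_num.
  move=> Eu; have := fg u u Eu Eu; rewrite mdistxx mul0e.
  by case: (f u).
pose F u := fine `|f u|%E.
pose g1 u := (g u + +oo * (\1_E u)%:E)%E.
have mE : mu.-cara.-measurable E by exact: null_cara.
have F0 u : 0 <= F u by rewrite /F fine_ge0.
have g10 u : (0 <= g1 u)%E by rewrite /g1 adde_ge0// mule_ge0// lee_fin.
have FE u : ~ E u -> (F u)%:E = `|f u|%E.
  by move=> /ffinE fu; rewrite /F fineK// abse_fin_num.
have g1E u : ~ E u -> g1 u = g u.
  by move=> Eu; rewrite /g1 indicE memNset// mule0 adde0.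
have mabs : measurable_function mu (fun u => `|f u|%E).
  exact: (measurableT_comp (@abse_measurable _ _) mf).
have mF : measurable_function mu (fun u => (F u)%:E).
  by apply/measurable_EFinP; exact: measurableT_comp.
have mg1 : measurable_function mu g1.
  apply: emeasurable_funD => //; apply: measurable_funeM.
  by apply/measurable_EFinP; exact: measurable_indic.
have mB z t := cara_ball hM z t.
have intF z t : (\int[nu]_(y in ball z t) (F y)%:E =
    \int[nu]_(y in ball z t) `|f y|)%E.
  by apply: (eq_off_null_integral E0) => // u; rewrite lee_fin.
have Fg1 u v : (`|F u - F v|%:E <= (mdist u v)%:E * (g1 u + g1 v))%E.
  have [->|uv] := eqVneq u v.
    by rewrite subrr normr0 mule_ge0 ?adde_ge0// lee_fin mdist_ge0.
  have d0 : (0 < (mdist u v)%:E)%E by rewrite lte_fin mdist_gt0.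
  have g1y w : E w -> g1 w = +oo%E.
    move=> Ew; rewrite /g1 indicE mem_set// mule1 addey//.
    by rewrite gt_eqF// (lt_le_trans _ (g0 w)).
  have [Eu|Eu] := pselect (E u).
    rewrite (g1y u Eu) addye ?gt0_muley ?leey//.
    by rewrite gt_eqF// (lt_le_trans _ (g10 v)).
  have [Ev|Ev] := pselect (E v).
    rewrite (g1y v Ev) addey ?gt0_muley ?leey//.
    by rewrite gt_eqF// (lt_le_trans _ (g10 u)).
  rewrite !g1E//; apply: le_trans (fg u v Eu Ev).
  have := ffinE u Eu; have := ffinE v Ev; rewrite /F.
  case: (f u) => // a; case: (f v) => // b _ _ /=.
  by rewrite lee_fin; exact: ler_dist_dist.
have MF x : fractional_maximal mu alpha f x =
    fractional_maximal mu alpha (fun u => (F u)%:E) x.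
  rewrite /fractional_maximal; congr ereal_sup; apply: eq_imagel => r _.
  congr (_ * _)%E; rewrite -intF; apply: eq_integral => y _.
  by rewrite gee0_abs// lee_fin.
have Mg x : fractional_maximal mu (alpha * s) (fun u => g u `^ s)%E x =
    fractional_maximal mu (alpha * s) (fun u => g1 u `^ s)%E x.
  rewrite /fractional_maximal; congr ereal_sup; apply: eq_imagel => r _.
  congr (_ * _)%E; apply: (eq_off_null_integral E0) => //.
  - apply: (measurableT_comp (@abse_measurable _ _)).
    exact: (measurableT_comp (measurable_poweR s)).
  - apply: (measurableT_comp (@abse_measurable _ _)).
    exact: (measurableT_comp (measurable_poweR s)).
  - by move=> u Eu; rewrite g1E.
have Ffin z t : (\int[nu]_(y in ball z t) (F y)%:E < +oo)%E by rewrite intF.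
have g1fin z t : (\int[nu]_(y in ball z t) g1 y < +oo)%E.
  rewrite (eq_off_null_integral E0 _ mg1 mg)//.
have one_sided x y : x != y -> (fractional_maximal mu alpha f x <=
    fractional_maximal mu alpha f y + (mdist x y)%:E * ((gradient_const s)%:E *
      fractional_maximal mu (alpha * s) (fun u => g u `^ s) x `^ s^-1))%E.
  move=> xy; rewrite !MF Mg.
  exact: (fractional_one_sided alpha0 s1 F0 g10 mF mg1 Ffin g1fin Fg1).
exists [set x | fractional_maximal mu alpha f x = +oo%E] => // x y /= Mx My.
have [->|xy] := eqVneq x y.
  rewrite mdistxx mul0e; move: My (fractional_maximal_ge0 hM alpha f y).
  case: (fractional_maximal mu alpha f y) => // a _ _.
  by rewrite -EFinB subrr abse0.
have d0 : (0 <= (mdist x y)%:E)%E by rewrite lee_fin mdist_ge0.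
rewrite ge0_muleDr//.
have := one_sided x y xy; rewrite eq_sym in xy; have := one_sided y x xy.
rewrite (metric_sym y x); move: (h0 x) (h0 y).
set hx := ((gradient_const s)%:E * _)%E; set hy := ((gradient_const s)%:E * _)%E.
move=> hx0 hy0.
have dx0 : (0 <= (mdist x y)%:E * hx)%E by rewrite mule_ge0.
have dy0 : (0 <= (mdist x y)%:E * hy)%E by rewrite mule_ge0.
move: ((mdist x y)%:E * hx)%E ((mdist x y)%:E * hy)%E dx0 dy0 => dx dy dx0 dy0.
move: Mx My (fractional_maximal_ge0 hM alpha f x)
  (fractional_maximal_ge0 hM alpha f y).
case: (fractional_maximal mu alpha f x) => // a _.
case: (fractional_maximal mu alpha f y) => // b _ a0 b0.
case: dx dx0 => [dx||]// dx0; last by rewrite addye ?leey// gt_eqF// (lt_le_trans _ dy0).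
case: dy dy0 => [dy||]// dy0; last by rewrite addey ?leey.
rewrite -EFinB -!EFinD !lee_fin => h1 h2; rewrite lee_fin in dx0; rewrite lee_fin in dy0.
by rewrite ler_norml; apply/andP; split; lra.
Qed.

End FractionalGradient.

(** * Constants and the theorem *)

Section Assembly.
Context (R : realType) (X : pmetricType R).
Variable mu : {outer_measure set X -> \bar R}.
Hypothesis hM : metric_measure mu.
Local Notation nu := (cara_measure mu).
Local Notation T := (caratheodory_type mu).

(** Positive bounds [N] suffice even for [b = 0], by letting [N] tend to [0]. *)
Lemma le_scale_bounds (a b : \bar R) (C : R) : 0 < C -> (0 <= b)%E ->
  (forall N, 0 < N -> (b <= N%:E -> a <= (C * N)%:E)%E) -> (a <= C%:E * b)%E.
Proof.
move=> C0 b0 h; case: b b0 h => [b||]// b0 h; last first.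
  by rewrite gt0_muley ?lte_fin// leey.
rewrite lee_fin in b0; apply/lee_addgt0Pr => e e0.
have eC : 0 < e / C by rewrite divr_gt0.
have bN : 0 < b + e / C by rewrite ltr_wpDl.
apply: (le_trans (h _ bN _)); first by rewrite lee_fin lerDl ltW.
by rewrite -EFinM -EFinD lee_fin mulrDr mulrCA divff ?mulr1// gt_eqF.
Qed.

Lemma morrey_norm_ge0 p q f : (0 <= morrey_norm mu p q f)%E.
Proof.
apply: le_ereal_sup_tmp; eexists; first by exists (point, 1) => /=.
by rewrite mule_ge0 ?poweR_ge0.
Qed.

Lemma morrey_bound_finite p q N f : 0 < p -> measurable_function mu f ->
  morrey_bound mu p q N f -> mu [set x | f x = +oo%E] = 0%E.
Proof.
move=> p0 mf h.
have mfp : measurable_fun [set: T] (fun x => `|f x| `^ p)%E.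
  apply: (measurableT_comp (measurable_poweR p)).
  exact: (measurableT_comp (@abse_measurable _ _) mf).
pose D n : set T := ball (point : X) n.+1%:R.
have mD n : measurable (D n) by exact: cara_ball.
have Dint n : nu.-integrable (D n) (fun x => `|f x| `^ p)%E.
  apply/integrableP; split; first exact: measurable_funTS.
  under eq_integral do rewrite gee0_abs ?poweR_ge0//.
  by apply: le_lt_trans (h _ _ _) _; rewrite ?ltr0n// ltry.
have neg := negligible_bigcup (fun n => integrable_ae (mD n) (Dint n)).
have [B [mB B0 hB]] := neg.
apply/eqP; rewrite eq_le outer_measure_ge0 andbT -B0.
apply: le_outer_measure => x /= fx; apply: hB.
exists (Num.bound (mdist (point : X) x)) => //= h1.
have : D (Num.bound (mdist (point : X) x)) x.
  apply/ballP; apply: (lt_trans (unstable.ltr_bound _)).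
  by rewrite ltr_nat.
by move=> /h1; rewrite fx /= gt_eqF.
Qed.

Lemma morrey_locally_integrable p q N f : 1 < p -> 0 < q -> 0 < N ->
  measurable_function mu f -> morrey_bound mu p q N f ->
  forall z t, (\int[nu]_(y in ball z t) `|f y| < +oo)%E.
Proof.
move=> p1 q0 N0 mf h z t.
apply: (@le_lt_trans _ _ (\int[nu]_(y in ball z (`|t| + 1)) `|f y|)%E).
  apply: ge0_le_integral_set => //; apply: ball_sub; rewrite mdistxx add0r.
  by rewrite ler_wpDr// ler_norm.
have t0 : 0 < `|t| + 1 by rewrite ltr_wpDl.
have m0 := ball_mass_gt0 hM z t0.
have := morrey_average hM z p1 N0 q0 mf h t0.
by rewrite lee_pdivrMl// => /le_lt_trans; apply; rewrite -EFinM ltry.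
Qed.

Lemma adams_const_gt0 (C0 c theta p q : R) : 1 <= C0 -> 0 < c -> 1 < p ->
  0 < adams_const C0 c theta p q.
Proof.
move=> hC0 c0 p1; have C00 : 0 < C0 by exact: lt_le_trans hC0.
rewrite /adams_const mulr_gt0 ?powR_gt0 ?mulr_gt0 ?powR_gt0//.
by rewrite addr_gt0 ?powR_gt0// maximal_const_gt0.
Qed.

End Assembly.

(** The constants depend on the numerical data only, not on the space. *)
Lemma adams_uniform (R : realType) (C0 c Q alpha p q : R) :
  1 <= C0 -> 0 < c -> 0 < Q -> 1 < p -> p <= q -> 0 <= alpha -> alpha * q < Q ->
  exists2 A : R, 0 < A &
    forall (X : pmetricType R) (mu : {outer_measure set X -> \bar R}),
    metric_measure mu -> doubling mu C0 -> measure_lower_bound mu c Q ->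
    forall N f, 0 < N -> measurable_function mu f -> morrey_bound mu p q N f ->
    morrey_bound mu (p / (1 - alpha * q / Q)) (q / (1 - alpha * q / Q)) (A * N)
      (fractional_maximal mu alpha f).
Proof.
move=> hC0 c0 Q0 p1 pq alpha0 aqQ.
have q0 : 0 < q by apply: lt_le_trans pq; exact: lt_trans p1.
exists (adams_const C0 c (alpha * q / Q) p q); first exact: adams_const_gt0.
move=> X mu hM hD hL N f N0 mf fN.
apply: (adams hM hC0 hD c0 hL Q0 p1 pq (erefl _)) => //.
- by rewrite !mulr_ge0 ?invr_ge0 ?(ltW q0) ?(ltW Q0).
- by rewrite ltr_pdivrMr// mul1r.
Qed.

Lemma hajlasz_gradient_uniform (R : realType) (C0 C1 s : R) :
  1 <= C0 -> 0 < C1 -> 1 < s ->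
  exists2 K : R, 0 < K &
    forall (X : pmetricType R) (mu : {outer_measure set X -> \bar R}),
    metric_measure mu -> doubling mu C0 -> relative_1_annular_decay mu C1 ->
    forall (f g : X -> \bar R) (alpha : R), 0 <= alpha ->
    measurable_function mu f -> measurable_function mu g ->
    hajlasz_gradient mu f g ->
    (forall z t, (\int[cara_measure mu]_(y in ball z t) `|f y| < +oo)%E) ->
    (forall z t, (\int[cara_measure mu]_(y in ball z t) g y < +oo)%E) ->
    mu [set x | fractional_maximal mu alpha f x = +oo%E] = 0%E ->
    hajlasz_gradient mu (fractional_maximal mu alpha f)
      (fun x => K%:E *
        fractional_maximal mu (alpha * s) (fun u => g u `^ s) x `^ s^-1)%E.
Proof.
move=> hC0 hC1 s1; exists (gradient_const C0 C1 s).
  exact: gradient_const_gt0.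
move=> X mu hM hD hA f g alpha alpha0 mf mg fg ffin gfin Minf.
exact: (fractional_hajlasz_gradient hM hC0 hD hC1 hA).
Qed.

Lemma powR_root (R : realType) (a b s : R) : 0 <= a -> 0 <= b -> s != 0 ->
  (a * b `^ s) `^ s^-1 = a `^ s^-1 * b.
Proof.
move=> a0 b0 s0.
by rewrite (powRM _ a0 (powR_ge0 b s)) -powRrM mulfV// powRr1.
Qed.

Theorem theorem5p13 (R : realType) (C0 c C1 Q p q alpha : R)
    (hC0 : 1 <= C0) (hc : 0 < c) (hC1 : 0 < C1) (hQ : 0 < Q)
    (hp : 1 < p) (hpq : p <= q) (halpha0 : 0 <= alpha) (halpha : alpha < Q / q) :
  let pstar := Q * p / (Q - alpha * q) in
  let qstar := Q * q / (Q - alpha * q) in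
  exists2 C : R, 0 < C &
    forall (X : pmetricType R) (mu : {outer_measure set X -> \bar R}),
    metric_measure mu ->
    doubling mu C0 ->
    measure_lower_bound mu c Q ->
    relative_1_annular_decay mu C1 ->
    forall f : X -> \bar R,
    hajlasz_morrey_sobolev mu p q f ->
    hajlasz_morrey_sobolev mu pstar qstar (fractional_maximal mu alpha f) /\
    (hajlasz_morrey_sobolev_norm mu pstar qstar (fractional_maximal mu alpha f)
       <= C%:E * hajlasz_morrey_sobolev_norm mu p q f)%E.
Proof.
move=> pstar qstar.
have p0 : 0 < p by exact: lt_trans hp.
have q0 : 0 < q by exact: lt_le_trans hpq.
have aqQ : alpha * q < Q by rewrite -ltr_pdivlMr.
have Qaq : 0 < Q - alpha * q by rewrite subr_gt0.
have theta'0 : 0 < 1 - alpha * q / Q by rewrite subr_gt0 ltr_pdivrMr// mul1r.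
have pstarE : pstar = p / (1 - alpha * q / Q).
  by rewrite /pstar; field; rewrite !gt_eqF.
have qstarE : qstar = q / (1 - alpha * q / Q).
  by rewrite /qstar; field; rewrite !gt_eqF.
(* Any exponent strictly between [1] and [p] would do. *)
pose s := (1 + p) / 2.
have s1 : 1 < s by rewrite /s; lra.
have s0 : 0 < s by exact: lt_trans s1.
have ps1 : 1 < p / s by rewrite ltr_pdivlMr// /s; lra.
have psqs : p / s <= q / s by rewrite ler_pM2r// invr_gt0.
have ps0 : 0 < pstar by rewrite pstarE divr_gt0.
have as0 : 0 <= alpha * s by rewrite mulr_ge0// ltW.
have asq : alpha * s * (q / s) < Q.
  by rewrite mulrACA mulfV ?gt_eqF// mulr1.
have [A1 A10 adams1] := adams_uniform hC0 hc hQ hp hpq halpha0 aqQ.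
have [A A0 adams2] := adams_uniform hC0 hc hQ ps1 psqs as0 asq.
have [K K0 gradK] := hajlasz_gradient_uniform hC0 hC1 s1.
have A20 : 0 < K * A `^ s^-1 by rewrite mulr_gt0// powR_gt0.
pose A2 := K * A `^ s^-1.
exists (A1 + A2); first exact: (addr_gt0 A10 A20).
move=> X mu hM hD hL hA f [mf [h0 h0grad [mh0 h0norm]] fnorm].
set M := fractional_maximal mu alpha f.
have mM : measurable_function mu M by exact: measurable_fractional_maximal.
pose grad g x : \bar R := (K%:E *
  fractional_maximal mu (alpha * s) (fun u => g u `^ s) x `^ s^-1)%E.
have mpow g (r : R) : measurable_function mu g ->
    measurable_function mu (fun u => g u `^ r)%E.
  by move=> mg; exact: (measurableT_comp (measurable_poweR r)).
have mgrad g : measurable_function mu g -> measurable_function mu (grad g).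
  move=> mg; apply: measurable_funeM; apply: (mpow).
  by apply: measurable_fractional_maximal => //; exact: (mpow).
have inf0 p' q' f' : (0 <= ereal_inf [set morrey_norm mu p' q' h
    | h in [set h | measurable_function mu h /\ hajlasz_gradient mu f' h]])%E.
  by apply: le_ereal_inf_tmp => _ [h _ <-]; exact: morrey_norm_ge0.
have normM : (morrey_norm mu pstar qstar M <= A1%:E * morrey_norm mu p q f)%E.
  apply: le_scale_bounds => //; first exact: morrey_norm_ge0.
  move=> N N0 fN; apply/(morrey_boundP hM) => //; first by rewrite mulr_gt0.
  by rewrite pstarE qstarE; apply: adams1 => //; exact/(morrey_boundP hM).
have normgrad g : measurable_function mu g -> (forall x, 0 <= g x)%E ->
    (morrey_norm mu pstar qstar (grad g) <= A2%:E * morrey_norm mu p q g)%E.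
  move=> mg g0; apply: le_scale_bounds => //; first exact: morrey_norm_ge0.
  move=> N N0 gN.
  have Ns0 : 0 < N `^ s by rewrite powR_gt0.
  have gN' : morrey_bound mu p q N g by exact/(morrey_boundP hM).
  have b1 := adams2 X mu hM hD hL _ _ Ns0 (mpow g s mg)
    (morrey_bound_pow s0 N0 g0 gN').
  have si0 : 0 < s^-1 by rewrite invr_gt0.
  have AN0 : 0 < A * N `^ s by rewrite mulr_gt0.
  have := morrey_bound_pow si0 AN0 (fractional_maximal_ge0 hM _ _) b1.
  have -> : p / s / (1 - alpha * s * (q / s) / Q) / s^-1 = pstar.
    by rewrite /pstar; field; rewrite !gt_eqF.
  have -> : q / s / (1 - alpha * s * (q / s) / Q) / s^-1 = qstar.
    by rewrite /qstar; field; rewrite !gt_eqF.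
  rewrite (powR_root (ltW A0) (ltW N0)) ?gt_eqF//.
  move=> b2; apply/(morrey_boundP hM) => //; first by rewrite mulr_gt0.
  rewrite /A2 -mulrA; apply: (morrey_boundZ hM) => //.
  - by rewrite mulr_ge0 ?powR_ge0// ltW.
  - exact: ltW.
  - apply: (mpow); apply: measurable_fractional_maximal => //; exact: (mpow).
  - by move=> x; exact: poweR_ge0.
have bounded g : (morrey_norm mu p q g < +oo)%E ->
    exists2 N, 0 < N & morrey_bound mu p q N g.
  move=> gfin; have g0 := morrey_norm_ge0 mu p q g.
  have gf : morrey_norm mu p q g \is a fin_num by rewrite ge0_fin_numE.
  exists (fine (morrey_norm mu p q g) + 1); first by rewrite ltr_wpDl// fine_ge0.
  apply/(morrey_boundP hM) => //; first by rewrite ltr_wpDl// fine_ge0.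
  by rewrite EFinD fineK// leeDl.
have fMorrey : (morrey_norm mu p q f < +oo)%E.
  apply: le_lt_trans fnorm; rewrite /hajlasz_morrey_sobolev_norm leeDl//.
have [Nf Nf0 fN] := bounded f fMorrey.
have Minf : mu [set x | M x = +oo%E] = 0%E.
  have MN : morrey_bound mu pstar qstar (A1 * Nf) M.
    by rewrite pstarE qstarE; exact: (adams1 X mu hM hD hL Nf f Nf0 mf fN).
  exact: (morrey_bound_finite hM ps0 mM MN).
have gradP g : measurable_function mu g -> hajlasz_gradient mu f g ->
    (morrey_norm mu p q g < +oo)%E -> hajlasz_gradient mu M (grad g).
  move=> mg hg gfin; have [N N0 gN] := bounded g gfin; have [g0 _] := hg.
  apply: (gradK X mu hM hD hA) => //.
    exact: (morrey_locally_integrable hM hp q0 Nf0 mf fN).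
  move=> z t; have := morrey_locally_integrable hM hp q0 N0 mg gN z t.
  by under eq_integral do rewrite gee0_abs//.
have main : (hajlasz_morrey_sobolev_norm mu pstar qstar M <=
    (A1 + A2)%:E * hajlasz_morrey_sobolev_norm mu p q f)%E.
  rewrite /hajlasz_morrey_sobolev_norm ge0_muleDr ?morrey_norm_ge0//.
  apply: leeD.
    apply: (le_trans normM); rewrite lee_wpmul2r ?morrey_norm_ge0// lee_fin.
    by rewrite lerDl ltW.
  set IM := ereal_inf _; set If := ereal_inf _.
  apply: (@le_trans _ _ (A2%:E * If)%E); last first.
    by rewrite lee_wpmul2r ?inf0// lee_fin lerDr ltW.
  rewrite -lee_pdivrMl//; apply: le_ereal_inf_tmp => _ [g [mg hg] <-].
  rewrite lee_pdivrMl//; have [gy|gfin] := eqVneq (morrey_norm mu p q g) +oo%E.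
    by rewrite gy gt0_muley ?lte_fin// leey.
  have {}gfin : (morrey_norm mu p q g < +oo)%E by rewrite lt_neqAle gfin leey.
  apply: le_trans (normgrad g mg hg.1); apply: ereal_inf_lbound.
  by exists (grad g) => //; split; [exact: mgrad|exact: gradP].
split => //; split => //.
  exists (grad h0); first exact: gradP.
  split; first exact: mgrad.
  apply: (le_lt_trans (normgrad h0 mh0 h0grad.1)).
  by apply: lte_mul_pinfty; rewrite ?lee_fin ?(ltW A20).
apply: (le_lt_trans main); apply: lte_mul_pinfty => //.
by rewrite lee_fin addr_ge0// ltW.
Qed.
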